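(* A pseudocompact C$^*$-algebra $A$ is pseudomatricial if and only if its center is $Z(A)=\mathbb{C}I$, where $I$ is the identity of $A$.
   Context: $M_n$ denotes the C$^*$-algebra of complex $n\times n$ matrices, $n\ge 1$. Finite-dimensional C$^*$-algebras are, up to isomorphism, the (nonempty) finite direct sums of matrix algebras $M_n$. Continuous logic for C$^*$-algebras: atomic formulae are norms $\|P(x_1,\dots,x_k)\|$ of $*$-polynomials with complex coefficients (a constant $I$ for the identity may be used when the algebras are unital); formulae are built from these by applying continuous real-valued functions to finitely many formulae and by taking $\sup$ or $\inf$ of a variable over the closed unit ball. A sentence is a formula without free variables; $\varphi^A\in\mathbb{R}$ is its value in $A$. $A\equiv B$ (elementarily equivalent) if $\varphi^A=\varphi^B$ for every sentence $\varphi$. For an ultrafilter $\mathcal{U}$ on a set $J$, the ultraproduct $\prod_{\mathcal{U}}A_i$ is the C$^*$-algebra of bounded families $(a_i)_{i\in J}$ modulo those with $\lim_{\mathcal{U}}\|a_i\|=0$. A C$^*$-algebra is pseudocompact if it is elementarily equivalent to an ultraproduct of finite-dimensional C$^*$-algebras, and pseudomatricial if it is elementarily equivalent to an ultraproduct of matrix algebras; it is not required to be infinite-dimensional. Such algebras are unital. *)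

(* Defs.v *)
From HB Require Import structures.
From mathcomp Require Import all_boot all_order all_algebra.
From mathcomp Require Import complex.
From mathcomp Require Import all_classical all_reals all_analysis.
From mathcomp Require Import ring lra.

Set Implicit Arguments.
Unset Strict Implicit.
Unset Printing Implicit Defensive.

Import Order.TTheory GRing.Theory Num.Theory.
Import numFieldNormedType.Exports.
Import Normc.

Local Open Scope classical_set_scope.
Local Open Scope complex_scope.
Local Open Scope sesquilinear_scope.
Local Open Scope ring_scope.

Section Modulus.
Context {R : realType}.
Implicit Types c d : R[i].

Lemma normc_norm c : (normc c)%:C = `|c|.
Proof. by []. Qed.

Lemma normc_ge0 c : 0 <= normc c.
Proof. by rewrite -lecR normc_norm normr_ge0. Qed.

Lemma normc_conj c : normc c^* = normc c.
Proof. by apply: complexI; rewrite !normc_norm norm_conjC. Qed.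

Lemma normc_sum (I : finType) (f : I -> R[i]) :
  normc (\sum_i f i) <= \sum_i normc (f i).
Proof.
rewrite -lecR rmorph_sum [leLHS]normc_norm.
exact: le_trans (ler_norm_sum _ _ _) _.
Qed.

End Modulus.

(* C*-algebras are not assumed to be unital.  They are complete normed spaces
   over R[i], so their norm takes values in R[i]; [cnorm] below is the same norm
   with values in R. *)
HB.mixin Record isCstar (R : realType) A & CompleteNormedModule R[i] A := {
  cmul : A -> A -> A;
  star : A -> A;
  cmulA : associative cmul;
  cmulDl : left_distributive cmul +%R;
  cmulDr : right_distributive cmul +%R;
  cscalerAl : forall (c : R[i]) (x y : A), c *: cmul x y = cmul (c *: x) y;
  cscalerAr : forall (c : R[i]) (x y : A), c *: cmul x y = cmul x (c *: y);
  starK : involutive star;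
  starD : {morph star : x y / x + y};
  starZ : forall (c : R[i]) (x : A), star (c *: x) = c^* *: star x;
  starM : forall x y : A, star (cmul x y) = cmul (star y) (star x);
  cnormrM : forall x y : A, `|cmul x y| <= `|x| * `|y|;
  cstar_id : forall x : A, `|cmul (star x) x| = `|x| ^+ 2
}.

#[short(type="cstarType")]
HB.structure Definition Cstar (R : realType) :=
  {A of isCstar R A & CompleteNormedModule R[i] A}.

Arguments cmul {R A} : rename.
Arguments star {R A} : rename.

(* Builds a C*-algebra from a real-valued norm, completeness being stated for
   Cauchy sequences. *)
HB.factory Record Lmodule_isCstar (R : realType) A & GRing.Lmodule R[i] A := {
  rnorm : A -> R;
  rnormD : forall x y, rnorm (x + y) <= rnorm x + rnorm y;
  rnormZ : forall (c : R[i]) x, rnorm (c *: x) = normc c * rnorm x;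
  rnorm0_eq0 : forall x, rnorm x = 0 -> x = 0;
  rnorm_complete : forall u : nat -> A,
    (forall e : R, 0 < e -> exists N, forall m n,
       (N <= m)%N -> (N <= n)%N -> rnorm (u m - u n) < e) ->
    exists l, forall e : R, 0 < e -> exists N, forall n,
       (N <= n)%N -> rnorm (l - u n) < e;
  mul : A -> A -> A;
  adj : A -> A;
  mulA : associative mul;
  mulDl : left_distributive mul +%R;
  mulDr : right_distributive mul +%R;
  scaleAl : forall (c : R[i]) (x y : A), c *: mul x y = mul (c *: x) y;
  scaleAr : forall (c : R[i]) (x y : A), c *: mul x y = mul x (c *: y);
  adjK : involutive adj;
  adjD : {morph adj : x y / x + y};
  adjZ : forall (c : R[i]) (x : A), adj (c *: x) = c^* *: adj x;
  adjM : forall x y : A, adj (mul x y) = mul (adj y) (adj x);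
  rnormM : forall x y : A, rnorm (mul x y) <= rnorm x * rnorm y;
  rnorm_adj : forall x : A, rnorm (mul (adj x) x) = rnorm x ^+ 2
}.

HB.builders Context (R : realType) A & Lmodule_isCstar R A.

Let norm (x : A) : R[i] := (rnorm x)%:C.

Let normD x y : norm (x + y) <= norm x + norm y.
Proof. by rewrite /norm -rmorphD lecR; exact: rnormD. Qed.

Let normZ (c : R[i]) x : norm (c *: x) = `|c| * norm x.
Proof. by rewrite /norm rnormZ rmorphM. Qed.

Let norm0_eq0 x : norm x = 0 -> x = 0.
Proof. by move=> [/rnorm0_eq0]. Qed.

HB.instance Definition _ :=
  @Lmodule_isNormed.Build R[i] A norm normD normZ norm0_eq0.

Let normE (x : A) : `|x| = (rnorm x)%:C. Proof. by []. Qed.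

Let complete (F : set_system A) : ProperFilter F -> cauchy F -> cvg F.
Proof.
move=> PF /cauchyP cF.
have inv_gt0 n : 0 < (n.+1%:R^-1 : R) by rewrite invr_gt0.
have invC_gt0 n : 0 < ((n.+1%:R^-1 : R)%:C : R[i]) by rewrite ltcR.
have /choice[u Fu] (n : nat) : exists x : A, F (ball x (n.+1%:R^-1 : R)%:C).
  exact: cF (invC_gt0 n).
have dist m n : rnorm (u m - u n) < m.+1%:R^-1 + n.+1%:R^-1.
  have [z []] := filter_ex (filterI (Fu m) (Fu n)).
  rewrite -!ball_normE /= !normE !ltcR => zm zn.
  have -> : u m - u n = (u m - z) + (z - u n) by rewrite addrA subrK.
  apply: le_lt_trans (rnormD _ _) (ltrD zm _).
  by move: (distrC z (u n)); rewrite !normE => -[->].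
have small (e : R) : 0 < e -> exists N, forall n, (N <= n)%N -> n.+1%:R^-1 < e.
  move=> e0; exists (Num.truncn e^-1) => n Nn.
  rewrite invf_plt ?posrE//.
  apply: lt_le_trans (truncnS_gt _) _.
  by rewrite ler_nat ltnS.
have [l ul] : exists l, forall e : R, 0 < e -> exists N, forall n,
       (N <= n)%N -> rnorm (l - u n) < e.
  apply: rnorm_complete => e e0.
  have [N HN] := small _ (divr_gt0 e0 (ltr0n _ 2)).
  exists N => m n Nm Nn; apply: lt_trans (dist m n) _.
  by rewrite [e]splitr ltrD// HN.
apply/cvg_ex; exists l; apply/fcvgrPdist_lt => /= e e0.
have eE : e = (complex.Re e)%:C by rewrite RRe_real// gtr0_real.
move: e0; rewrite eE ltcR => e0.
have [N HN] := small _ (divr_gt0 e0 (ltr0n _ 2)).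
have [M HM] := ul _ (divr_gt0 e0 (ltr0n _ 2)).
apply: filterS (Fu (maxn N M)) => y.
rewrite -ball_normE /= !normE !ltcR => uy.
have -> : l - y = (l - u (maxn N M)) + (u (maxn N M) - y) by rewrite addrA subrK.
apply: le_lt_trans (rnormD _ _) _.
rewrite [ltRHS]splitr ltrD// ?HM ?leq_maxr//.
by apply: lt_trans uy _; rewrite HN// leq_maxl.
Qed.

HB.instance Definition _ := Uniform_isComplete.Build A complete.

Let normM x y : `|mul x y| <= `|x| * `|y|.
Proof. by rewrite !normE -rmorphM lecR; exact: rnormM. Qed.

Let norm_adj x : `|mul (adj x) x| = `|x| ^+ 2.
Proof. by rewrite !normE rnorm_adj rmorphXn. Qed.

HB.instance Definition _ := @isCstar.Build R A mul adj mulA mulDl mulDr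
  scaleAl scaleAr adjK adjD adjZ adjM normM norm_adj.

HB.end.

Definition cnorm (R : realType) (A : cstarType R) (x : A) : R := complex.Re `|x|.
Arguments cnorm : simpl never.

Section CnormTheory.
Context {R : realType} {A : cstarType R}.
Implicit Types (x y : A).

Lemma cnormE x : `|x| = (cnorm x)%:C.
Proof. by rewrite /cnorm RRe_real// normr_real. Qed.

Lemma cnorm_ge0 x : 0 <= cnorm x.
Proof. by rewrite -lecR -cnormE normr_ge0. Qed.

Lemma cnorm0 : cnorm (0 : A) = 0.
Proof. by rewrite /cnorm normr0. Qed.

Lemma cnorm0_eq0 x : cnorm x = 0 -> x = 0.
Proof. by move=> x0; apply/normr0_eq0; rewrite cnormE x0. Qed.

Lemma cnormN x : cnorm (- x) = cnorm x.
Proof. by rewrite /cnorm normrN. Qed.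

Lemma cnormD x y : cnorm (x + y) <= cnorm x + cnorm y.
Proof. by rewrite -lecR rmorphD /= -!cnormE ler_normD. Qed.

Lemma cnormZ (c : R[i]) x : cnorm (c *: x) = normc c * cnorm x.
Proof. by apply: complexI; rewrite rmorphM -cnormE normrZ cnormE. Qed.

Lemma cnormM x y : cnorm (cmul x y) <= cnorm x * cnorm y.
Proof. by rewrite -lecR rmorphM /= -!cnormE cnormrM. Qed.

Lemma cnorm_star_id x : cnorm (cmul (star x) x) = cnorm x ^+ 2.
Proof. by apply: complexI; rewrite rmorphXn /= -!cnormE cstar_id. Qed.

Lemma cnorm_star x : cnorm (star x) = cnorm x.
Proof.
suff le y : cnorm y <= cnorm (star y).
  by apply/eqP; rewrite eq_le le andbT -{2}[x]starK le.
have [->|y0] := eqVneq (cnorm y) 0; first exact: cnorm_ge0.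
have y_gt0 : 0 < cnorm y by rewrite lt0r y0 cnorm_ge0.
by rewrite -(ler_pM2r y_gt0) -expr2 -cnorm_star_id cnormM.
Qed.

Lemma cnorm_complete (u : nat -> A) :
  (forall e : R, 0 < e -> exists N, forall m n,
     (N <= m)%N -> (N <= n)%N -> cnorm (u m - u n) < e) ->
  exists l : A, forall e : R, 0 < e -> exists N, forall n,
     (N <= n)%N -> cnorm (l - u n) < e.
Proof.
move=> cu; have : cauchy (u @ \oo).
  apply/cauchy_ballP => e e0.
  have eE : e = (complex.Re e)%:C by rewrite RRe_real// gtr0_real.
  move: e0; rewrite eE ltcR => /cu[N HN].
  exists ([set u n | n in [set n | (N <= n)%N]],
          [set u n | n in [set n | (N <= n)%N]]) => /=.
    by split; exists N => // n /= Nn; exists n.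
  move=> [_ _] /= [[m Nm <-] [n Nn <-]].
  by rewrite -ball_normE /= cnormE ltcR HN.
move=> /cauchy_cvg /cvg_ex[l /cvgrPdist_lt ul]; exists l => e e0.
have /ul [N _ HN] : 0 < e%:C by rewrite ltcR.
by exists N => n Nn; rewrite -ltcR -cnormE HN.
Qed.

End CnormTheory.

(* The C*-algebra of bounded families (a_j), with pointwise operations and the
   supremum norm.  Over a finite index type it is the direct sum. *)
Section BoundedFamilies.
Context {R : realType} {J : Type} (F : J -> cstarType R).

Record bfamily := BFamily {
  bval :> forall j, F j;
  bvalP : exists M : R, forall j, cnorm (bval j) <= M
}.

Lemma bfamily_ext (a b : bfamily) : (forall j, a j = b j) -> a = b.
Proof.
case: a b => [a aP] [b bP] /= ab.
have {}ab : a = b by apply: functional_extensionality_dep.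
by case: _ / ab bP => bP; congr BFamily; exact: Prop_irrelevance.
Qed.

HB.instance Definition _ := gen_eqMixin bfamily.
HB.instance Definition _ := gen_choiceMixin bfamily.

Definition bfamily_zero : bfamily.
Proof.
by exists (fun j => 0); exists 0 => j; rewrite cnorm0 lexx.
Defined.

Definition bfamily_opp (a : bfamily) : bfamily.
Proof.
exists (fun j => - a j); have [M aM] := bvalP a.
by exists M => j; rewrite cnormN; exact: aM.
Defined.

Definition bfamily_add (a b : bfamily) : bfamily.
Proof.
exists (fun j => a j + b j); have [M aM] := bvalP a; have [N bN] := bvalP b.
by exists (M + N) => j; apply: le_trans (cnormD _ _) (lerD (aM j) (bN j)).
Defined.

Definition bfamily_scale (c : R[i]) (a : bfamily) : bfamily.
Proof.
exists (fun j => c *: a j); have [M aM] := bvalP a.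
exists (normc c * M) => j; rewrite cnormZ ler_wpM2l//.
exact: normc_ge0.
Defined.

Definition bfamily_mul (a b : bfamily) : bfamily.
Proof.
exists (fun j => cmul (a j) (b j)).
have [M aM] := bvalP a; have [N bN] := bvalP b.
exists (M * N) => j; apply: le_trans (cnormM _ _) _.
by rewrite ler_pM// ?cnorm_ge0.
Defined.

Definition bfamily_star (a : bfamily) : bfamily.
Proof.
exists (fun j => star (a j)); have [M aM] := bvalP a.
by exists M => j; rewrite cnorm_star; exact: aM.
Defined.

Let addA : associative bfamily_add.
Proof. by move=> a b c; apply: bfamily_ext => j; exact: addrA. Qed.
Let addC : commutative bfamily_add.
Proof. by move=> a b; apply: bfamily_ext => j; exact: addrC. Qed.
Let add0 : left_id bfamily_zero bfamily_add.
Proof. by move=> a; apply: bfamily_ext => j; exact: add0r. Qed.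
Let addN : left_inverse bfamily_zero bfamily_opp bfamily_add.
Proof. by move=> a; apply: bfamily_ext => j; exact: addNr. Qed.

HB.instance Definition _ := GRing.isZmodule.Build bfamily addA addC add0 addN.

Let scaleA c d (a : bfamily) :
  bfamily_scale c (bfamily_scale d a) = bfamily_scale (c * d) a.
Proof. by apply: bfamily_ext => j; exact: scalerA. Qed.
Let scale1 : left_id 1 bfamily_scale.
Proof. by move=> a; apply: bfamily_ext => j; exact: scale1r. Qed.
Let scaleDr : right_distributive bfamily_scale +%R.
Proof. by move=> c a b; apply: bfamily_ext => j; exact: scalerDr. Qed.
Let scaleDl (a : bfamily) : {morph bfamily_scale^~ a : c d / c + d}.
Proof. by move=> c d; apply: bfamily_ext => j; exact: scalerDl. Qed.

HB.instance Definition _ := GRing.Zmodule_isLmodule.Build R[i] bfamily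
  scaleA scale1 scaleDr scaleDl.

Definition bfamily_norm (a : bfamily) : R := sup (range (fun j => cnorm (a j))).

Lemma bfamily_norm_ge (a : bfamily) j : cnorm (a j) <= bfamily_norm a.
Proof.
apply: ub_le_sup; last by exists j.
by have [M aM] := bvalP a; exists M => _ [i _ <-].
Qed.

Lemma bfamily_norm_le (a : bfamily) (M : R) :
  0 <= M -> (forall j, cnorm (a j) <= M) -> bfamily_norm a <= M.
Proof.
move=> M0 aM; rewrite /bfamily_norm; set S := range (fun j => cnorm (a j)).
have [->|/set0P S0] := eqVneq S set0; first by rewrite sup0.
by apply: ge_sup => // _ [j _ <-].
Qed.

Lemma bfamily_norm_ge0 (a : bfamily) : 0 <= bfamily_norm a.
Proof.
rewrite /bfamily_norm; set S := range (fun j => cnorm (a j)).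
have [->|/set0P [_ [j _ _]]] := eqVneq S set0; first by rewrite sup0.
exact: le_trans (cnorm_ge0 (a j)) (bfamily_norm_ge a j).
Qed.

Let normD (a b : bfamily) :
  bfamily_norm (a + b) <= bfamily_norm a + bfamily_norm b.
Proof.
apply: bfamily_norm_le => [|j]; first by rewrite addr_ge0 ?bfamily_norm_ge0.
by apply: le_trans (cnormD _ _) _; rewrite lerD ?bfamily_norm_ge.
Qed.

Let normZ_le (c : R[i]) (a : bfamily) :
  bfamily_norm (c *: a) <= normc c * bfamily_norm a.
Proof.
have c0 : 0 <= normc c by exact: normc_ge0.
apply: bfamily_norm_le => [|j]; first by rewrite mulr_ge0 ?bfamily_norm_ge0.
by rewrite cnormZ ler_wpM2l ?bfamily_norm_ge.
Qed.

Let normZ (c : R[i]) (a : bfamily) :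
  bfamily_norm (c *: a) = normc c * bfamily_norm a.
Proof.
apply/eqP; rewrite eq_le normZ_le andTb.
have [->|c0] := eqVneq c 0.
  by rewrite normc0 mul0r bfamily_norm_ge0.
have cp : 0 < normc c by rewrite -ltcR normc_norm normr_gt0.
rewrite mulrC -ler_pdivlMr//.
have {1}-> : a = c^-1 *: (c *: a) by rewrite scalerA mulVf// scale1r.
apply: le_trans (normZ_le _ _) _; rewrite mulrC.
apply: ler_wpM2l; first exact: bfamily_norm_ge0.
by rewrite normcV.
Qed.

Let norm0_eq0 (a : bfamily) : bfamily_norm a = 0 -> a = 0.
Proof.
move=> a0; apply: bfamily_ext => j; apply: cnorm0_eq0; apply/eqP.
by rewrite eq_le cnorm_ge0 andbT -a0 bfamily_norm_ge.
Qed.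

Let complete (u : nat -> bfamily) :
  (forall e : R, 0 < e -> exists N, forall m n,
     (N <= m)%N -> (N <= n)%N -> bfamily_norm (u m - u n) < e) ->
  exists l, forall e : R, 0 < e -> exists N, forall n,
     (N <= n)%N -> bfamily_norm (l - u n) < e.
Proof.
move=> cu.
have lim j : exists l : F j, forall e : R, 0 < e -> exists N, forall n,
    (N <= n)%N -> cnorm (l - u n j) < e.
  apply: cnorm_complete => e /cu[N HN]; exists N => m n Nm Nn.
  exact: le_lt_trans (bfamily_norm_ge (u m - u n) j) (HN _ _ Nm Nn).
pose l j := projT1 (cid (lim j)).
have close (e : R) : 0 < e -> exists N, forall j n,
    (N <= n)%N -> cnorm (l j - u n j) <= e.
  move=> e0; have [N HN] := cu _ (divr_gt0 e0 (ltr0n _ 2)).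
  exists N => j n Nn; rewrite /l; case: cid => /= lj ulj.
  have [M HM] := ulj _ (divr_gt0 e0 (ltr0n _ 2)).
  have -> : lj - u n j = (lj - u (maxn N M) j) + (u (maxn N M) - u n) j.
    by rewrite addrA subrK.
  apply: le_trans (cnormD _ _) _; rewrite [leRHS]splitr lerD//.
    by apply/ltW/HM; rewrite leq_maxr.
  apply: le_trans (bfamily_norm_ge _ _) _.
  by apply/ltW/HN => //; rewrite leq_maxl.
have lP : exists M : R, forall j, cnorm (l j) <= M.
  have [N HN] := close 1 ltr01; exists (1 + bfamily_norm (u N)) => j.
  rewrite -[l j](subrK (u N j)); apply: le_trans (cnormD _ _) _.
  by rewrite lerD ?bfamily_norm_ge// HN.
exists (BFamily lP) => e e0.
have [N HN] := close _ (divr_gt0 e0 (ltr0n _ 2)).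
exists N => n Nn.
apply: (@le_lt_trans _ _ (e / 2)); last by rewrite gtr_pMr// invf_lt1 ?ltr1n.
apply: bfamily_norm_le => [|j]; first by rewrite divr_ge0 ?ltW.
exact: HN.
Qed.

Let mulA : associative bfamily_mul.
Proof. by move=> a b c; apply: bfamily_ext => j; exact: cmulA. Qed.
Let mulDl : left_distributive bfamily_mul +%R.
Proof. by move=> a b c; apply: bfamily_ext => j; exact: cmulDl. Qed.
Let mulDr : right_distributive bfamily_mul +%R.
Proof. by move=> a b c; apply: bfamily_ext => j; exact: cmulDr. Qed.
Let scaleAl (c : R[i]) (a b : bfamily) :
  c *: bfamily_mul a b = bfamily_mul (c *: a) b.
Proof. by apply: bfamily_ext => j; exact: cscalerAl. Qed.
Let scaleAr (c : R[i]) (a b : bfamily) :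
  c *: bfamily_mul a b = bfamily_mul a (c *: b).
Proof. by apply: bfamily_ext => j; exact: cscalerAr. Qed.
Let starK : involutive bfamily_star.
Proof. by move=> a; apply: bfamily_ext => j; exact: starK. Qed.
Let starD : {morph bfamily_star : a b / a + b}.
Proof. by move=> a b; apply: bfamily_ext => j; exact: starD. Qed.
Let starZ (c : R[i]) (a : bfamily) :
  bfamily_star (c *: a) = c^* *: bfamily_star a.
Proof. by apply: bfamily_ext => j; exact: starZ. Qed.
Let starM (a b : bfamily) :
  bfamily_star (bfamily_mul a b) = bfamily_mul (bfamily_star b) (bfamily_star a).
Proof. by apply: bfamily_ext => j; exact: starM. Qed.
Let normM (a b : bfamily) :
  bfamily_norm (bfamily_mul a b) <= bfamily_norm a * bfamily_norm b.
Proof.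
apply: bfamily_norm_le => [|j]; first by rewrite mulr_ge0 ?bfamily_norm_ge0.
by apply: le_trans (cnormM _ _) _; rewrite ler_pM ?cnorm_ge0 ?bfamily_norm_ge.
Qed.
Let norm_star (a : bfamily) :
  bfamily_norm (bfamily_mul (bfamily_star a) a) = bfamily_norm a ^+ 2.
Proof.
apply/eqP; rewrite eq_le; apply/andP; split.
  apply: bfamily_norm_le => [|j]; first by rewrite exprn_ge0 ?bfamily_norm_ge0.
  by rewrite cnorm_star_id lerXn2r ?bfamily_norm_ge// nnegrE
    ?bfamily_norm_ge0 ?cnorm_ge0.
set b := bfamily_mul _ _.
rewrite -[leRHS]sqr_sqrtr ?bfamily_norm_ge0// lerXn2r ?nnegrE ?sqrtr_ge0
  ?bfamily_norm_ge0//.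
apply: bfamily_norm_le => [|j]; first exact: sqrtr_ge0.
rewrite -[leLHS]ger0_norm ?cnorm_ge0// -sqrtr_sqr ler_wsqrtr// -cnorm_star_id.
exact: (bfamily_norm_ge b j).
Qed.

HB.instance Definition _ := @Lmodule_isCstar.Build R bfamily
  bfamily_norm normD normZ norm0_eq0 complete bfamily_mul bfamily_star
  mulA mulDl mulDr scaleAl scaleAr starK starD starZ starM normM norm_star.

End BoundedFamilies.

Section EuclideanNorm.
Context {R : realType}.

Definition vnorm n (x : 'cV[R[i]]_n) : R :=
  Num.sqrt (\sum_i normc (x i 0) ^+ 2).

Lemma vnorm_ge0 n (x : 'cV[R[i]]_n) : 0 <= vnorm x.
Proof. exact: sqrtr_ge0. Qed.

Lemma sqr_vnorm n (x : 'cV[R[i]]_n) : vnorm x ^+ 2 = \sum_i normc (x i 0) ^+ 2.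
Proof. by rewrite sqr_sqrtr// sumr_ge0// => i _; exact: sqr_ge0. Qed.

Lemma vnormZ n c (x : 'cV[R[i]]_n) : vnorm (c *: x) = normc c * vnorm x.
Proof.
rewrite /vnorm -[normc c in RHS]ger0_norm ?normc_ge0// -sqrtr_sqr -sqrtrM ?sqr_ge0//.
congr Num.sqrt; rewrite mulr_sumr; apply: eq_bigr => i _.
by rewrite mxE -exprMn; congr (_ ^+ 2); exact: normcM.
Qed.

Lemma vnorm0 n : vnorm (0 : 'cV[R[i]]_n) = 0.
Proof.
apply/eqP; rewrite -sqrf_eq0 sqr_vnorm big1// => i _.
by rewrite mxE normc0 expr0n.
Qed.

Lemma vnorm0_eq0 n (x : 'cV[R[i]]_n) : vnorm x = 0 -> x = 0.
Proof.
move=> /(congr1 (fun r => r ^+ 2)); rewrite sqr_vnorm expr0n /=.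
move=> /eqP; rewrite psumr_eq0 => [/allP x0|i _]; last exact: sqr_ge0.
apply/matrixP => i j; rewrite (ord1 j) mxE; apply/normr0_eq0; rewrite -normc_norm.
by have := x0 i (mem_index_enum _); rewrite sqrf_eq0 => /eqP ->.
Qed.

Lemma real_cauchy_schwarz n (p q : 'I_n -> R) :
  (\sum_i p i * q i) ^+ 2 <= (\sum_i p i ^+ 2) * (\sum_i q i ^+ 2).
Proof.
set P := \sum_i p i ^+ 2; set Q := \sum_i q i ^+ 2; set S := \sum_i _.
have Q0 : 0 <= Q by apply: sumr_ge0 => i _; exact: sqr_ge0.
have [Qz|Qnz] := eqVneq Q 0.
  suff -> : S = 0 by rewrite Qz expr0n mulr0.
  move/eqP: Qz; rewrite psumr_eq0 => [/allP q0|i _]; last exact: sqr_ge0.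
  apply: big1 => i _; have := q0 i (mem_index_enum _).
  by rewrite sqrf_eq0 => /eqP ->; rewrite mulr0.
have : 0 <= \sum_i (Q * p i - S * q i) ^+ 2.
  by apply: sumr_ge0 => i _; exact: sqr_ge0.
have -> : \sum_i (Q * p i - S * q i) ^+ 2 = Q * (P * Q - S ^+ 2).
  transitivity (\sum_i (Q ^+ 2 * p i ^+ 2 - 2 * Q * S * (p i * q i) +
      S ^+ 2 * q i ^+ 2)); first by apply: eq_bigr => i _; ring.
  rewrite big_split sumrB /= -!mulr_sumr -/P -/Q -/S.
  by move: P Q S {Q0 Qnz} => P Q S; ring.
by rewrite pmulr_rge0 ?subr_ge0// lt0r Qnz Q0.
Qed.

Definition vdot n (x y : 'cV[R[i]]_n) : R[i] := \sum_i x i 0 * (y i 0)^*.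

Lemma vdotxx n (x : 'cV[R[i]]_n) : vdot x x = (vnorm x ^+ 2)%:C.
Proof.
rewrite sqr_vnorm rmorph_sum; apply: eq_bigr => i _.
by rewrite -normCK rmorphXn /= normc_norm.
Qed.

Lemma vdot_le n (x y : 'cV[R[i]]_n) : normc (vdot x y) <= vnorm x * vnorm y.
Proof.
apply: le_trans (normc_sum _) _.
under eq_bigr do rewrite normcM normc_conj.
rewrite -[leLHS]ger0_norm; last first.
  by apply: sumr_ge0 => i _; rewrite mulr_ge0 ?normc_ge0.
rewrite -sqrtr_sqr /vnorm -sqrtrM ?sumr_ge0// => [|i _]; last exact: sqr_ge0.
by apply: ler_wsqrtr; exact: real_cauchy_schwarz.
Qed.

Lemma vdotDl n (x y z : 'cV[R[i]]_n) : vdot (x + y) z = vdot x z + vdot y z.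
Proof.
by rewrite -big_split; apply: eq_bigr => i _; rewrite mxE mulrDl.
Qed.

Lemma vnormD n (x y : 'cV[R[i]]_n) : vnorm (x + y) <= vnorm x + vnorm y.
Proof.
have [->|xy0] := eqVneq (vnorm (x + y)) 0.
  by rewrite addr_ge0 ?vnorm_ge0.
have xy_gt0 : 0 < vnorm (x + y) by rewrite lt0r xy0 vnorm_ge0.
rewrite -(ler_pM2r xy_gt0) -expr2 mulrDl.
have -> : vnorm (x + y) ^+ 2 = normc (vdot (x + y) (x + y)).
  apply: complexI; rewrite normc_norm vdotxx ger0_norm//.
  by rewrite lecR sqr_ge0.
by rewrite vdotDl (le_trans (le_normcD _ _))// lerD ?vdot_le.
Qed.

Lemma vdot_adj n (A : 'M[R[i]]_n) (x y : 'cV[R[i]]_n) :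
  vdot (A *m x) y = vdot x (A ^t* *m y).
Proof.
rewrite /vdot; under eq_bigr => i _ do rewrite mxE mulr_suml.
rewrite exchange_big /=; apply: eq_bigr => j _.
rewrite mxE rmorph_sum mulr_sumr; apply: eq_bigr => i _ /=.
by rewrite rmorphM !mxE /= conjCK mulrA [A i j * _]mulrC.
Qed.

Lemma vnorm_coord n (x : 'cV[R[i]]_n) i : normc (x i 0) <= vnorm x.
Proof.
rewrite -[leLHS]ger0_norm ?normc_ge0// -sqrtr_sqr ler_wsqrtr//.
by rewrite (bigD1 i)//= lerDl sumr_ge0// => j _; exact: sqr_ge0.
Qed.

Lemma vnorm_sum n (I : finType) (f : I -> 'cV[R[i]]_n) :
  vnorm (\sum_i f i) <= \sum_i vnorm (f i).
Proof.
elim/big_ind2 : _ => [|a b c d ab cd|//]; first by rewrite vnorm0.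
exact: le_trans (vnormD _ _) (lerD ab cd).
Qed.

Lemma vnorm_le n (x : 'cV[R[i]]_n) : vnorm x <= \sum_i normc (x i 0).
Proof.
have -> : x = \sum_i x i 0 *: delta_mx i 0.
  by rewrite [LHS]matrix_sum_delta; apply: eq_bigr => i _; rewrite big_ord1.
apply: le_trans (vnorm_sum _) _; apply: ler_sum => i _.
rewrite vnormZ summxE (bigD1 i)//= big1 => [|j ji]; last first.
  by rewrite !mxE eq_sym (negPf ji) mulr0.
rewrite !mxE !eqxx mulr1 addr0 ler_piMr ?normc_ge0//.
rewrite -[leRHS]sqrtr1 ler_wsqrtr// (bigD1 i)//= big1 => [|j ji]; last first.
  by rewrite mxE (negPf ji) normc0 expr0n.
by rewrite mxE !eqxx normc1 addr0 expr1n.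
Qed.

End EuclideanNorm.

Section OperatorNorm.
Context {R : realType}.

Definition opnorm n (A : 'M[R[i]]_n) : R :=
  sup [set vnorm (A *m x) | x in [set x | vnorm x <= 1]].

Lemma opnorm_le n (A : 'M[R[i]]_n) (M : R) : 0 <= M ->
  (forall x, vnorm (A *m x) <= M * vnorm x) -> opnorm A <= M.
Proof.
move=> M0 AM; apply: ge_sup => [|_ [x x1 <-]].
  by exists (vnorm (A *m 0)), 0 => //=; rewrite vnorm0.
by apply: le_trans (AM x) _; rewrite ler_piMr.
Qed.

Lemma vnorm_delta n (j : 'I_n) : vnorm (delta_mx j 0 : 'cV[R[i]]_n) <= 1.
Proof.
rewrite -[leRHS]sqrtr1 ler_wsqrtr// (bigD1 j)//= big1 => [|i ij]; last first.
  by rewrite mxE (negPf ij) normc0 expr0n.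
by rewrite mxE !eqxx normc1 addr0 expr1n.
Qed.

Lemma mulmx_delta n (A : 'M[R[i]]_n) i j :
  (A *m (delta_mx j 0 : 'cV_n)) i 0 = A i j.
Proof.
rewrite mxE (bigD1 j)//= big1 => [|k kj]; last first.
  by rewrite mxE (negPf kj) mulr0.
by rewrite mxE !eqxx mulr1 addr0.
Qed.

Lemma mulmx_coord n (A : 'M[R[i]]_n) (x : 'cV[R[i]]_n) :
  A *m x = \sum_j x j 0 *: (A *m delta_mx j 0).
Proof.
rewrite [in LHS](matrix_sum_delta x) mulmx_sumr; apply: eq_bigr => j _.
by rewrite big_ord1 scalemxAr.
Qed.

Let opnorm_set_bounded n (A : 'M[R[i]]_n) :
  has_ubound [set vnorm (A *m x) | x in [set x | vnorm x <= 1]].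
Proof.
exists (\sum_j vnorm (A *m delta_mx j 0)) => _ [x x1 <-].
rewrite mulmx_coord; apply: le_trans (vnorm_sum _) _; apply: ler_sum => j _.
rewrite vnormZ ler_piMl ?vnorm_ge0//.
exact: le_trans (vnorm_coord x j) x1.
Qed.

Lemma opnorm_ge0 n (A : 'M[R[i]]_n) : 0 <= opnorm A.
Proof.
apply: le_trans (_ : vnorm (A *m 0) <= _); first exact: vnorm_ge0.
by apply: ub_le_sup => //; exists 0 => //=; rewrite vnorm0.
Qed.

Lemma opnorm_mulmx n (A : 'M[R[i]]_n) x : vnorm (A *m x) <= opnorm A * vnorm x.
Proof.
have [/vnorm0_eq0 ->|x0] := eqVneq (vnorm x) 0.
  by rewrite mulmx0 vnorm0 mulr0.
have x_gt0 : 0 < vnorm x by rewrite lt0r x0 vnorm_ge0.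
have rE (r : R) : 0 <= r -> normc r%:C = r.
  by move=> r0; apply: complexI; rewrite normc_norm ger0_norm ?lecR.
rewrite -ler_pdivrMr// mulrC -[X in X * _]rE ?invr_ge0 ?vnorm_ge0//.
rewrite -vnormZ scalemxAr; apply: ub_le_sup => //; exists (((vnorm x)^-1)%:C *: x) => //=.
by rewrite vnormZ rE ?invr_ge0 ?vnorm_ge0// mulVf.
Qed.

Lemma opnormD n (A B : 'M[R[i]]_n) : opnorm (A + B) <= opnorm A + opnorm B.
Proof.
apply: opnorm_le => [|x]; first by rewrite addr_ge0 ?opnorm_ge0.
by rewrite mulmxDl mulrDl (le_trans (vnormD _ _))// lerD ?opnorm_mulmx.
Qed.

Let opnormZ_le n (c : R[i]) (A : 'M[R[i]]_n) :
  opnorm (c *: A) <= normc c * opnorm A.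
Proof.
apply: opnorm_le => [|x]; first by rewrite mulr_ge0 ?opnorm_ge0 ?normc_ge0.
by rewrite -scalemxAl vnormZ -mulrA ler_wpM2l ?normc_ge0 ?opnorm_mulmx.
Qed.

Lemma opnormZ n (c : R[i]) (A : 'M[R[i]]_n) :
  opnorm (c *: A) = normc c * opnorm A.
Proof.
apply/eqP; rewrite eq_le opnormZ_le andTb.
have [->|c0] := eqVneq c 0; first by rewrite normc0 mul0r opnorm_ge0.
have cp : 0 < normc c by rewrite -ltcR normc_norm normr_gt0.
rewrite mulrC -ler_pdivlMr//.
have {1}-> : A = c^-1 *: (c *: A) by rewrite scalerA mulVf// scale1r.
by apply: le_trans (opnormZ_le _ _) _; rewrite mulrC normcV.
Qed.

Lemma opnorm_coord n (A : 'M[R[i]]_n) i j : normc (A i j) <= opnorm A.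
Proof.
rewrite -mulmx_delta.
apply: le_trans (vnorm_coord _ _) _; apply: le_trans (opnorm_mulmx _ _) _.
by rewrite ler_piMr ?opnorm_ge0 ?vnorm_delta.
Qed.

Lemma opnorm_le_sum n (A : 'M[R[i]]_n) :
  opnorm A <= \sum_j \sum_i normc (A i j).
Proof.
apply: opnorm_le => [|x].
  by rewrite !sumr_ge0// => j _; rewrite sumr_ge0// => i _; exact: normc_ge0.
rewrite mulmx_coord; apply: le_trans (vnorm_sum _) _.
rewrite mulr_suml; apply: ler_sum => j _; rewrite vnormZ mulrC.
apply: ler_pM; rewrite ?vnorm_ge0 ?normc_ge0 ?vnorm_coord//.
apply: le_trans (vnorm_le _) _; apply: ler_sum => i _.
by rewrite mulmx_delta.
Qed.

Lemma opnorm0_eq0 n (A : 'M[R[i]]_n) : opnorm A = 0 -> A = 0.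
Proof.
move=> A0; apply/matrixP => i j; rewrite mxE; apply: eq0_normc; apply/eqP.
by rewrite eq_le normc_ge0 andbT -A0 opnorm_coord.
Qed.

Lemma opnormM n (A B : 'M[R[i]]_n) : opnorm (A *m B) <= opnorm A * opnorm B.
Proof.
apply: opnorm_le => [|x]; first by rewrite mulr_ge0 ?opnorm_ge0.
rewrite -mulmxA -mulrA (le_trans (opnorm_mulmx _ _))// ler_wpM2l ?opnorm_ge0//.
exact: opnorm_mulmx.
Qed.

Let sqr_vnorm_vdot n (x : 'cV[R[i]]_n) : vnorm x ^+ 2 = normc (vdot x x).
Proof.
by apply: complexI; rewrite normc_norm vdotxx ger0_norm// lecR sqr_ge0.
Qed.

Let opnorm_adj_le n (A : 'M[R[i]]_n) : opnorm (A ^t*) <= opnorm A.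
Proof.
apply: opnorm_le => [|x]; first exact: opnorm_ge0.
set y := A ^t* *m x; have [->|y0] := eqVneq (vnorm y) 0.
  by rewrite mulr_ge0 ?opnorm_ge0 ?vnorm_ge0.
have y_gt0 : 0 < vnorm y by rewrite lt0r y0 vnorm_ge0.
rewrite -(ler_pM2r y_gt0) -expr2 sqr_vnorm_vdot {2}/y -vdot_adj.
apply: le_trans (vdot_le _ _) _.
by rewrite mulrAC ler_wpM2r ?vnorm_ge0 ?opnorm_mulmx.
Qed.

Lemma opnorm_adj n (A : 'M[R[i]]_n) : opnorm (A ^t* *m A) = opnorm A ^+ 2.
Proof.
apply/eqP; rewrite eq_le; apply/andP; split.
  by rewrite (le_trans (opnormM _ _))// expr2 ler_wpM2r ?opnorm_ge0.
set B := A ^t* *m A.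
rewrite -[leRHS]sqr_sqrtr ?opnorm_ge0// lerXn2r ?nnegrE ?sqrtr_ge0
  ?opnorm_ge0//.
apply: opnorm_le => [|x]; first exact: sqrtr_ge0.
rewrite -[vnorm x]ger0_norm ?vnorm_ge0// -sqrtr_sqr -sqrtrM ?opnorm_ge0//.
rewrite -[leLHS]ger0_norm ?vnorm_ge0// -sqrtr_sqr ler_wsqrtr//.
rewrite sqr_vnorm_vdot vdot_adj mulmxA -/B (le_trans (vdot_le _ _))//.
by rewrite mulrC expr2 mulrA ler_wpM2r ?vnorm_ge0 ?opnorm_mulmx.
Qed.

Let real_complete (u : nat -> R) :
  (forall e : R, 0 < e -> exists N, forall m n,
     (N <= m)%N -> (N <= n)%N -> `|u m - u n| < e) ->
  exists l, forall e : R, 0 < e -> exists N, forall n,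
     (N <= n)%N -> `|l - u n| < e.
Proof.
move=> cu; have : cauchy (u @ \oo).
  apply/cauchy_ballP => e /cu[N HN].
  exists ([set u n | n in [set n | (N <= n)%N]],
          [set u n | n in [set n | (N <= n)%N]]) => /=.
    by split; exists N => // n /= Nn; exists n.
  by move=> [_ _] /= [[m Nm <-] [n Nn <-]]; rewrite -ball_normE /= HN.
move=> /cauchy_cvg /cvg_ex[l /cvgrPdist_lt ul]; exists l => e /ul[N _ HN].
by exists N => n; exact: HN.
Qed.

Let complex_complete (u : nat -> R[i]) :
  (forall e : R, 0 < e -> exists N, forall m n,
     (N <= m)%N -> (N <= n)%N -> normc (u m - u n) < e) ->
  exists l, forall e : R, 0 < e -> exists N, forall n,
     (N <= n)%N -> normc (l - u n) < e.
Proof.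
have ReIm (a b : R) : [/\ `|a| <= normc (a +i* b), `|b| <= normc (a +i* b) &
    normc (a +i* b) <= `|a| + `|b|].
  split=> /=.
  - by rewrite -sqrtr_sqr ler_wsqrtr// lerDl sqr_ge0.
  - by rewrite -sqrtr_sqr ler_wsqrtr// lerDr sqr_ge0.
  rewrite -[leRHS]ger0_norm ?addr_ge0// -sqrtr_sqr ler_wsqrtr//.
  rewrite sqrrD !real_normK ?num_real// -addrA lerD2l lerDr.
  by rewrite mulrn_wge0 ?mulr_ge0.
move=> cu.
have [a ua] : exists a : R, forall e : R, 0 < e -> exists N, forall n,
     (N <= n)%N -> `|a - complex.Re (u n)| < e.
  apply: (@real_complete (fun n => complex.Re (u n))) => e /cu[N HN].
  exists N => m n Nm Nn; apply: le_lt_trans _ (HN _ _ Nm Nn).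
  by case: (u m) (u n) => [a b] [c d]; have [] := ReIm (a - c) (b - d).
have [b ub] : exists b : R, forall e : R, 0 < e -> exists N, forall n,
     (N <= n)%N -> `|b - complex.Im (u n)| < e.
  apply: (@real_complete (fun n => complex.Im (u n))) => e /cu[N HN].
  exists N => m n Nm Nn; apply: le_lt_trans _ (HN _ _ Nm Nn).
  by case: (u m) (u n) => [a' b] [c d]; have [] := ReIm (a' - c) (b - d).
exists (a +i* b) => e e0.
have [N HN] := ua _ (divr_gt0 e0 (ltr0n _ 2)).
have [M HM] := ub _ (divr_gt0 e0 (ltr0n _ 2)).
exists (maxn N M) => n; rewrite geq_max => /andP[Nn Mn].
have := HN _ Nn; have := HM _ Mn; case: (u n) => [c d] /= bd ac.
have [_ _ +] := ReIm (a - c) (b - d) => /le_lt_trans; apply.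
by rewrite [ltRHS]splitr ltrD.
Qed.

Lemma opnorm_complete n (u : nat -> 'M[R[i]]_n) :
  (forall e : R, 0 < e -> exists N, forall m k,
     (N <= m)%N -> (N <= k)%N -> opnorm (u m - u k) < e) ->
  exists l, forall e : R, 0 < e -> exists N, forall k,
     (N <= k)%N -> opnorm (l - u k) < e.
Proof.
move=> cu.
have lim i j : exists l : R[i], forall e : R, 0 < e -> exists N, forall k,
    (N <= k)%N -> normc (l - u k i j) < e.
  apply: complex_complete => e /cu[N HN]; exists N => m k Nm Nk.
  apply: le_lt_trans (HN _ _ Nm Nk).
  by have := opnorm_coord (u m - u k) i j; rewrite !mxE.
pose l := \matrix_(i, j) projT1 (cid (lim i j)).
have ul i j (e : R) : 0 < e -> exists N, forall k,
    (N <= k)%N -> normc (l i j - u k i j) < e.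
  by rewrite mxE; case: cid => /= lij; apply.
exists l => e e0.
pose d := e / (n * n).+1%:R.
have d0 : 0 < d by rewrite divr_gt0.
have /choice[N HN] (ij : 'I_n * 'I_n) : exists N, forall k,
    (N <= k)%N -> normc (l ij.1 ij.2 - u k ij.1 ij.2) < d.
  exact: ul.
exists (\max_ij N ij) => k Nk.
apply: le_lt_trans (opnorm_le_sum _) _.
apply: (@le_lt_trans _ _ (\sum_(j < n) \sum_(i < n) d)).
  apply: ler_sum => j _; apply: ler_sum => i _.
  have -> : (l - u k) i j = l i j - u k i j.
    by rewrite mxE; congr (_ + _); rewrite mxE.
  by apply/ltW/(HN (i, j)); apply: leq_trans (leq_bigmax (i, j)) Nk.
rewrite !sumr_const card_ord -mulrnA -mulr_natr /d -mulrA gtr_pMr//.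
by rewrite mulrC ltr_pdivrMr// mul1r ltr_nat.
Qed.

End OperatorNorm.

(* [mxalg R n] is M_{n+1}, with the operator norm and the conjugate transpose.
   The library's normed structure on matrices is the entrywise maximum norm,
   hence the alias. *)
Definition mxalg (R : realType) (n : nat) : Type := 'M[R[i]]_n.+1.

Section MatrixAlgebra.
Context (R : realType) (n : nat).
Local Notation M := (mxalg R n).

HB.instance Definition _ := GRing.Lmodule.copy M 'M[R[i]]_n.+1.

Definition mxalg_mul (A B : M) : M := A *m B.
Definition mxalg_adj (A : M) : M := A ^t*.
Local Notation mul := mxalg_mul.
Local Notation adj := mxalg_adj.

Let mulA : associative mul. Proof. exact: mulmxA. Qed.
Let mulDl : left_distributive mul +%R. Proof. exact: mulmxDl. Qed.
Let mulDr : right_distributive mul +%R. Proof. exact: mulmxDr. Qed.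
Let scaleAl (c : R[i]) (A B : M) : c *: mul A B = mul (c *: A) B.
Proof. exact: scalemxAl. Qed.
Let scaleAr (c : R[i]) (A B : M) : c *: mul A B = mul A (c *: B).
Proof. exact: scalemxAr. Qed.
Let adjK : involutive adj. Proof. exact: trmxCK. Qed.
Let adjD : {morph adj : A B / A + B}.
Proof. by move=> A B; apply/matrixP => i j; rewrite !mxE rmorphD. Qed.
Let adjZ (c : R[i]) (A : M) : adj (c *: A) = c^* *: adj A.
Proof. by apply/matrixP => i j; rewrite !mxE rmorphM. Qed.
Let adjM (A B : M) : adj (mul A B) = mul (adj B) (adj A).
Proof. by rewrite /mxalg_adj /mxalg_mul trmx_mul map_mxM. Qed.

HB.instance Definition _ := @Lmodule_isCstar.Build R M
  (@opnorm R n.+1) (@opnormD R n.+1) (@opnormZ R n.+1) (@opnorm0_eq0 R n.+1)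
  (@opnorm_complete R n.+1) mul adj mulA mulDl mulDr scaleAl scaleAr
  adjK adjD adjZ adjM (@opnormM R n.+1) (@opnorm_adj R n.+1).

End MatrixAlgebra.

(* The quotient of the bounded families by the families whose norms tend to 0
   along U; the norm of the class of (a_j) is lim_U ||a_j||
   (see [cnorm_uclass]). *)
Section Ultraproduct.
Context {R : realType} {J : Type} (U : set_system J) (UU : UltraFilter U).
Context (F : J -> cstarType R).

Definition ulim_norm (a : bfamily F) : R := lim (cnorm (a j) @[j --> U]).

Lemma cvg_ulim_norm (a : bfamily F) :
  cnorm (a j) @[j --> U] --> ulim_norm a.
Proof.
have [M aM] := bvalP a.
have : compact `[0, M]%classic by exact: segment_compact.
move=> /(_ (cnorm (a j) @[j --> U]) _)[].
  by apply: (@filterE _ U) => j /=; rewrite in_itv /= cnorm_ge0 aM.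
move=> p [_ pcl]; suff : cnorm (a j) @[j --> U] --> p.
  by move=> ap; apply/cvg_ex; exists p.
move=> B pB; have [//|BN] := in_ultra_setVsetC [set j | B (cnorm (a j))] UU.
have [x []] := pcl (~` B) B BN pB.
by [].
Qed.

Lemma ulim_norm_uniq (a : bfamily F) (l : R) :
  cnorm (a j) @[j --> U] --> l -> ulim_norm a = l.
Proof. by move=> al; apply: cvg_lim al; exact: Rhausdorff. Qed.

Let ulim_le (f g : J -> R) (l l' : R) :
  f @ U --> l -> g @ U --> l' -> (forall j, f j <= g j) -> l <= l'.
Proof.
move=> fl gl fg; rewrite -subr_ge0; pose h j := g j - f j.
have hl : h @ U --> l' - l by exact: cvgB.
apply: (@ler_cvg_to R (h @ U) _ R (cst 0) id) => //; first exact: cvg_cst.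
by apply: (@filterE _ U) => j; rewrite /= subr_ge0.
Qed.

Lemma ulim_norm_ge0 (a : bfamily F) : 0 <= ulim_norm a.
Proof.
apply: (@ulim_le (cst 0) (fun j => cnorm (a j))).
- exact: cvg_cst.
- exact: cvg_ulim_norm.
- by move=> j; exact: cnorm_ge0.
Qed.

Lemma ulim_normD (a b : bfamily F) :
  ulim_norm (a + b) <= ulim_norm a + ulim_norm b.
Proof.
apply: (@ulim_le (fun j => cnorm ((a + b) j))
  (fun j => cnorm (a j) + cnorm (b j))).
- exact: cvg_ulim_norm.
- by apply: cvgD; exact: cvg_ulim_norm.
- by move=> j; exact: cnormD.
Qed.

Lemma ulim_normZ (c : R[i]) (a : bfamily F) :
  ulim_norm (c *: a) = normc c * ulim_norm a.
Proof.
apply: ulim_norm_uniq.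
have -> : (fun j => cnorm ((c *: a) j)) = (fun j => normc c * cnorm (a j)).
  by apply/funext => j; exact: cnormZ.
by apply: cvgMl_tmp; exact: cvg_ulim_norm.
Qed.

Lemma ulim_normN (a : bfamily F) : ulim_norm (- a) = ulim_norm a.
Proof.
apply: ulim_norm_uniq.
have -> : (fun j => cnorm ((- a) j)) = (fun j => cnorm (a j)).
  by apply/funext => j; exact: cnormN.
exact: cvg_ulim_norm.
Qed.

Lemma ulim_normM (a b : bfamily F) :
  ulim_norm (bfamily_mul a b) <= ulim_norm a * ulim_norm b.
Proof.
apply: (@ulim_le (fun j => cnorm (bfamily_mul a b j))
  (fun j => cnorm (a j) * cnorm (b j))).
- exact: cvg_ulim_norm.
- by apply: (cvgM (@cvg_ulim_norm _) (@cvg_ulim_norm _)).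
- by move=> j; exact: cnormM.
Qed.

Lemma ulim_norm_star (a : bfamily F) : ulim_norm (bfamily_star a) = ulim_norm a.
Proof.
apply: ulim_norm_uniq.
have -> : (fun j => cnorm (bfamily_star a j)) = (fun j => cnorm (a j)).
  by apply/funext => j; exact: cnorm_star.
exact: cvg_ulim_norm.
Qed.

Lemma ulim_norm_star_id (a : bfamily F) :
  ulim_norm (bfamily_mul (bfamily_star a) a) = ulim_norm a ^+ 2.
Proof.
apply: ulim_norm_uniq.
have -> : (fun j => cnorm (bfamily_mul (bfamily_star a) a j)) =
    (fun j => cnorm (a j) * cnorm (a j)).
  by apply/funext => j; rewrite -expr2; exact: cnorm_star_id.
rewrite expr2; exact: (cvgM (@cvg_ulim_norm _) (@cvg_ulim_norm _)).
Qed.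

Lemma ulim_norm_le (a : bfamily F) : ulim_norm a <= bfamily_norm a.
Proof.
apply: (@ulim_le (fun j => cnorm (a j)) (cst (bfamily_norm a))).
- exact: cvg_ulim_norm.
- exact: cvg_cst.
- by move=> j; exact: bfamily_norm_ge.
Qed.

Definition null_family : {pred bfamily F} :=
  fun a => `[< cnorm (a j) @[j --> U] --> (0 : R) >].

Lemma null_familyE (a : bfamily F) : (a \in null_family) = (ulim_norm a == 0).
Proof.
apply/idP/eqP => [/asboolP /ulim_norm_uniq//|a0]; apply/asboolP.
by rewrite -[X in _ --> X]a0; exact: cvg_ulim_norm.
Qed.

Let null0 : ulim_norm 0 = 0.
Proof. by rewrite -(scale0r 0) ulim_normZ normc0 mul0r. Qed.

Let null_zmod_closed : zmod_closed null_family.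
Proof.
split=> [|a b]; rewrite !null_familyE; first exact/eqP.
move=> /eqP a0 /eqP b0; rewrite eq_le ulim_norm_ge0 andbT.
by rewrite (le_trans (ulim_normD _ _))// ulim_normN a0 b0 addr0.
Qed.

HB.instance Definition _ :=
  GRing.isZmodClosed.Build (bfamily F) null_family null_zmod_closed.

Definition ultraproduct : Type := {ideal_quot null_family}.

HB.instance Definition _ := Choice.on ultraproduct.
HB.instance Definition _ := GRing.Zmodule.on ultraproduct.

Local Open Scope quotient_scope.

Definition uclass (a : bfamily F) : ultraproduct := \pi_{ideal_quot null_family} a.

Definition urepr (x : ultraproduct) : bfamily F :=
  repr (x : {ideal_quot null_family}).

Lemma ureprK x : uclass (urepr x) = x.
Proof. exact: reprK. Qed.

Lemma uclass_eqP (a b : bfamily F) : uclass a = uclass b <-> ulim_norm (a - b) = 0.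
Proof.
split=> [/eqP|/eqP]; rewrite -?null_familyE.
  by rewrite -[X in is_true X]Quotient.idealrBE null_familyE => /eqP.
by rewrite Quotient.idealrBE => /eqP.
Qed.

Lemma urepr_class (a : bfamily F) : ulim_norm (urepr (uclass a) - a) = 0.
Proof. by apply/uclass_eqP; rewrite ureprK. Qed.

Lemma uclassD (a b : bfamily F) : uclass (a + b) = uclass a + uclass b.
Proof. exact: (raddfD \pi_{ideal_quot null_family}). Qed.

Lemma uclassN (a : bfamily F) : uclass (- a) = - uclass a.
Proof. exact: (raddfN \pi_{ideal_quot null_family}). Qed.

Definition uscale (c : R[i]) (x : ultraproduct) := uclass (c *: urepr x).
Definition umul (x y : ultraproduct) := uclass (bfamily_mul (urepr x) (urepr y)).
Definition ustar (x : ultraproduct) := uclass (bfamily_star (urepr x)).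
Definition unorm (x : ultraproduct) : R := ulim_norm (urepr x).

Lemma uclassZ (c : R[i]) (a : bfamily F) : uclass (c *: a) = uscale c (uclass a).
Proof.
apply/esym/uclass_eqP.
by rewrite -scalerBr ulim_normZ urepr_class mulr0.
Qed.

Let le0_eq0 (a : bfamily F) : ulim_norm a <= 0 -> ulim_norm a = 0.
Proof. by move=> a0; apply/eqP; rewrite eq_le a0 ulim_norm_ge0. Qed.

Lemma uclassM (a b : bfamily F) :
  uclass (bfamily_mul a b) = umul (uclass a) (uclass b).
Proof.
apply/esym/uclass_eqP; set a' := urepr _; set b' := urepr _.
have -> : bfamily_mul a' b' - bfamily_mul a b =
    bfamily_mul (a' - a) b' + bfamily_mul a (b' - b).
  have mBl (x y z : bfamily F) :
      bfamily_mul (x - y) z = bfamily_mul x z - bfamily_mul y z.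
    have mDl : left_distributive (@bfamily_mul _ _ F) +%R by exact: cmulDl.
    by apply/eqP; rewrite eq_sym subr_eq -mDl subrK.
  have mBr (x y z : bfamily F) :
      bfamily_mul x (y - z) = bfamily_mul x y - bfamily_mul x z.
    have mDr : right_distributive (@bfamily_mul _ _ F) +%R by exact: cmulDr.
    by apply/eqP; rewrite eq_sym subr_eq -mDr subrK.
  by rewrite mBl mBr addrA subrK.
apply/le0_eq0; apply: le_trans (ulim_normD _ _) _.
apply: le_trans (lerD (ulim_normM _ _) (ulim_normM _ _)) _.
by rewrite !urepr_class mul0r mulr0 addr0.
Qed.

Lemma uclass_star (a : bfamily F) : uclass (bfamily_star a) = ustar (uclass a).
Proof.
apply/esym/uclass_eqP; set a' := urepr _.
have -> : bfamily_star a' - bfamily_star a = bfamily_star (a' - a).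
  have sD : {morph @bfamily_star _ _ F : x y / x + y} by exact: starD.
  by apply/eqP; rewrite subr_eq -sD subrK.
by rewrite ulim_norm_star urepr_class.
Qed.

Lemma unorm_class (a : bfamily F) : unorm (uclass a) = ulim_norm a.
Proof.
rewrite /unorm; set a' := urepr _; apply/eqP; rewrite eq_le; apply/andP; split.
  rewrite -[a' in leLHS](subrK a) (le_trans (ulim_normD _ _))//.
  by rewrite urepr_class add0r.
rewrite -[a in leLHS](subrK a') (le_trans (ulim_normD _ _))//.
by rewrite -opprB ulim_normN urepr_class add0r.
Qed.

Let scaleA c d x : uscale c (uscale d x) = uscale (c * d) x.
Proof. by rewrite -[x]ureprK -!uclassZ scalerA. Qed.
Let scale1 : left_id 1 uscale.
Proof. by move=> x; rewrite -[x]ureprK -uclassZ scale1r. Qed.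
Let scaleDr : right_distributive uscale +%R.
Proof.
move=> c x y; rewrite -[x]ureprK -[y]ureprK.
by rewrite -uclassD -!uclassZ -uclassD scalerDr.
Qed.
Let scaleDl x : {morph uscale^~ x : c d / c + d}.
Proof.
by move=> c d; rewrite -[x]ureprK -!uclassZ -uclassD scalerDl.
Qed.

HB.instance Definition _ := GRing.Zmodule_isLmodule.Build R[i] ultraproduct
  scaleA scale1 scaleDr scaleDl.

Lemma uclass_scale (c : R[i]) (a : bfamily F) : uclass (c *: a) = c *: uclass a.
Proof. exact: uclassZ. Qed.

Let normD x y : unorm (x + y) <= unorm x + unorm y.
Proof.
by rewrite -[x]ureprK -[y]ureprK -uclassD !unorm_class ulim_normD.
Qed.

Let normZ (c : R[i]) (x : ultraproduct) : unorm (c *: x) = normc c * unorm x.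
Proof.
by rewrite -[x]ureprK -[_ *: _]uclassZ !unorm_class ulim_normZ.
Qed.

Let norm0_eq0 x : unorm x = 0 -> x = 0.
Proof.
rewrite -[x]ureprK unorm_class => x0.
have -> : 0 = uclass 0 by exact/esym/(raddf0 \pi_{ideal_quot null_family}).
by apply/uclass_eqP; rewrite subr0.
Qed.

Let small_lift (x : ultraproduct) (e : R) : 0 <= e -> unorm x < e ->
  exists a : bfamily F, uclass a = x /\ bfamily_norm a <= e.
Proof.
move=> e0 xe; set a := urepr x.
pose b j := if cnorm (a j) < e then a j else 0.
have be j : cnorm (b j) <= e.
  by rewrite /b; case: ifPn => [/ltW//|_]; rewrite cnorm0.
have bP : exists M : R, forall j, cnorm (b j) <= M by exists e.
exists (BFamily bP); split; last by apply: bfamily_norm_le.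
rewrite -[x]ureprK; apply/uclass_eqP/ulim_norm_uniq.
have Ue : U [set j | cnorm (a j) < e].
  exact: (@cvg_ulim_norm a _ (lt_nbhsl xe)).
apply/cvgrPdist_lt => /= d d0.
apply: filterS Ue => j /= aje.
by rewrite /b aje subrr cnorm0 subr0 normr0.
Qed.

Let complete (u : nat -> ultraproduct) :
  (forall e : R, 0 < e -> exists N, forall m n,
     (N <= m)%N -> (N <= n)%N -> unorm (u m - u n) < e) ->
  exists l, forall e : R, 0 < e -> exists N, forall n,
     (N <= n)%N -> unorm (l - u n) < e.
Proof.
move=> cu; pose h k : R := 2^-1 ^+ k.
have h0 k : 0 < h k by rewrite exprn_gt0// invr_gt0.
have /choice[N HN] k : exists N, forall m n,
    (N <= m)%N -> (N <= n)%N -> unorm (u m - u n) < h k by exact: cu.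
pose phi k := maxn k (\max_(i < k.+1) N i).
have Nphi k : (N k <= phi k)%N 
  by rewrite leq_max (leq_bigmax (Ordinal (ltnSn k))) orbT.
have phiS k : (phi k <= phi k.+1)%N.
  rewrite /phi [\max_(i < k.+2) _]big_ord_recr /=.
  by rewrite geq_max !leq_max leqnSn leqnn orbT.
have /choice[t Ht] k : exists a : bfamily F,
    uclass a = u (phi k.+1) - u (phi k) /\ bfamily_norm a <= h k.
  apply: small_lift; first exact/ltW.
  by apply: HN; rewrite ?Nphi// (leq_trans (Nphi k)).
pose b k := urepr (u (phi 0)) + \sum_(i < k) t i.
have bu k : uclass (b k) = u (phi k).
  elim: k => [|k IH]; first by rewrite /b big_ord0 addr0 ureprK.
  rewrite /b big_ord_recr /= addrA uclassD IH (Ht k).1.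
  by rewrite addrC subrK.
have step n k : bfamily_norm (b (n + k)%N - b n) <= 2 * h n - 2 * h (n + k)%N.
  elim: k => [|k IH].
    rewrite addn0 !subrr (_ : bfamily_norm 0 = 0)//.
    exact: (@cnorm0 _ (bfamily F)).
  have -> : b (n + k.+1)%N - b n = t (n + k)%N + (b (n + k)%N - b n).
    by rewrite addnS /b big_ord_recr /= !addrA [_ + t _]addrC !addrA.
  apply: le_trans (@cnormD _ (bfamily F) _ _) _.
  apply: le_trans (lerD (Ht _).2 IH) _.
  rewrite addnS (_ : h (n + k).+1 = 2^-1 * h (n + k)%N) ?/h ?exprS//.
  by lra.
have [e|l ul] := @cnorm_complete _ (bfamily F) b.
  move=> e0; have : h n @[n --> \oo] --> 0.
    by apply: cvg_expr; rewrite ger0_norm ?invf_lt1 ?ltr1n.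
  move=> /cvgrPdist_lt/(_ _ (divr_gt0 e0 (ltr0n _ 4)))[M _ HM].
  have {}HM n : (M <= n)%N -> 2 * h n < e / 2.
    move=> /HM /=; rewrite sub0r normrN ger0_norm ?ltW// => ?; lra.
  have bM n : (M <= n)%N -> cnorm (b n - b M) < e / 2.
    move=> Mn; have := step M (n - M)%N; rewrite subnKC// => /le_lt_trans; apply.
    by have := HM M (leqnn _); have := h0 n; lra.
  exists M => m n Mm Mn.
  have -> : b m - b n = (b m - b M) - (b n - b M) by rewrite opprB addrA subrK.
  apply: le_lt_trans (cnormD _ _) _; rewrite cnormN.
  by have := bM m Mm; have := bM n Mn; lra.
exists (uclass l) => e e0.
have [M HM] := ul _ (divr_gt0 e0 (ltr0n _ 2)).
have [K HK] := cu _ (divr_gt0 e0 (ltr0n _ 2)).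
pose k := maxn M K; have Kphi : (K <= phi k)%N.
  by rewrite /phi leq_max leq_maxr.
exists K => n Kn.
have -> : uclass l - u n = (uclass l - u (phi k)) + (u (phi k) - u n).
  by rewrite addrA subrK.
apply: le_lt_trans (normD _ _) _; rewrite [ltRHS]splitr ltrD ?HK//.
rewrite -bu -uclassN -uclassD unorm_class.
by apply: le_lt_trans (ulim_norm_le _) (HM _ _); rewrite leq_maxl.
Qed.

Let mulA : associative umul.
Proof.
move=> x y z; rewrite -[x]ureprK -[y]ureprK -[z]ureprK -!uclassM.
by congr uclass; exact: cmulA.
Qed.
Let mulDl : left_distributive umul +%R.
Proof.
move=> x y z; rewrite -[x]ureprK -[y]ureprK -[z]ureprK.
by rewrite -uclassD -!uclassM -uclassD; congr uclass; exact: cmulDl.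
Qed.
Let mulDr : right_distributive umul +%R.
Proof.
move=> x y z; rewrite -[x]ureprK -[y]ureprK -[z]ureprK.
by rewrite -uclassD -!uclassM -uclassD; congr uclass; exact: cmulDr.
Qed.
Let scaleAl (c : R[i]) (x y : ultraproduct) : c *: umul x y = umul (c *: x) y.
Proof.
rewrite -[x]ureprK -[y]ureprK -uclassM -!uclass_scale -uclassM.
by congr uclass; exact: cscalerAl.
Qed.
Let scaleAr (c : R[i]) (x y : ultraproduct) : c *: umul x y = umul x (c *: y).
Proof.
rewrite -[x]ureprK -[y]ureprK -uclassM -!uclass_scale -uclassM.
by congr uclass; exact: cscalerAr.
Qed.
Let starK : involutive ustar.
Proof.
move=> x; rewrite -[x]ureprK -!uclass_star.
by congr uclass; exact: starK.
Qed.
Let starD : {morph ustar : x y / x + y}.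
Proof.
move=> x y; rewrite -[x]ureprK -[y]ureprK -uclassD -!uclass_star -uclassD.
by congr uclass; exact: starD.
Qed.
Let starZ (c : R[i]) (x : ultraproduct) : ustar (c *: x) = c^* *: ustar x.
Proof.
rewrite -[x]ureprK -uclass_scale -!uclass_star -uclass_scale.
by congr uclass; exact: starZ.
Qed.
Let starM x y : ustar (umul x y) = umul (ustar y) (ustar x).
Proof.
rewrite -[x]ureprK -[y]ureprK -uclassM -!uclass_star -uclassM.
by congr uclass; exact: starM.
Qed.
Let normM x y : unorm (umul x y) <= unorm x * unorm y.
Proof.
by rewrite -[x]ureprK -[y]ureprK -uclassM !unorm_class ulim_normM.
Qed.
Let norm_star x : unorm (umul (ustar x) x) = unorm x ^+ 2.
Proof.
by rewrite -[x]ureprK -uclass_star -uclassM !unorm_class ulim_norm_star_id.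
Qed.

HB.instance Definition _ := @Lmodule_isCstar.Build R ultraproduct
  unorm normD normZ norm0_eq0 complete umul ustar
  mulA mulDl mulDr scaleAl scaleAr starK starD starZ starM normM norm_star.

Lemma cnorm_uclass (a : bfamily F) :
  cnorm (uclass a) = lim (cnorm (a j) @[j --> U]).
Proof. exact: unorm_class. Qed.

End Ultraproduct.

(* *-polynomials without constant term, in the variables indexed by 'I_n. *)
Inductive term (R : realType) (n : nat) : Type :=
| TVar of 'I_n
| TAdd of term R n & term R n
| TScale of R[i] & term R n
| TMul of term R n & term R n
| TStar of term R n.

Fixpoint teval (R : realType) (A : cstarType R) n (t : term R n)
    (v : 'I_n -> A) : A :=
  match t with
  | TVar i => v i
  | TAdd t1 t2 => teval t1 v + teval t2 v
  | TScale c t1 => c *: teval t1 v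
  | TMul t1 t2 => cmul (teval t1 v) (teval t2 v)
  | TStar t1 => star (teval t1 v)
  end.

(* Formulae whose free variables are indexed by 'I_n; the quantifiers bind
   variable 0 of a formula in n + 1 variables. *)
Inductive formula (R : realType) (n : nat) : Type :=
| FNorm of term R n
| FConn k (u : 'rV[R]_k -> R) of continuous u & ('I_k -> formula R n)
| FSup of formula R n.+1
| FInf of formula R n.+1.

Definition extend (T : Type) n (v : 'I_n -> T) (a : T) (i : 'I_n.+1) : T :=
  oapp v a (unlift ord0 i).

(* On assignments in the unit ball the values of a formula form a bounded set,
   so in a sentence [sup] and [inf] are never taken of an unbounded set. *)
Fixpoint feval (R : realType) (A : cstarType R) n (phi : formula R n)
    (v : 'I_n -> A) : R :=
  match phi with
  | FNorm t => cnorm (teval t v)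
  | FConn k u _ psi => u (\row_(i < k) feval (psi i) v)
  | FSup psi => sup [set feval psi (extend v a) | a in [set a : A | cnorm a <= 1]]
  | FInf psi => inf [set feval psi (extend v a) | a in [set a : A | cnorm a <= 1]]
  end.

Definition sentence (R : realType) := formula R 0.

Definition sentence_value (R : realType) (A : cstarType R) (phi : sentence R) : R :=
  feval phi (fun i : 'I_0 => 0 : A).

Definition elementarily_equivalent (R : realType) (A B : cstarType R) : Prop :=
  forall phi : sentence R, sentence_value A phi = sentence_value B phi.

(* *-isomorphisms of C*-algebras are automatically isometric. *)
Definition cstar_isomorphic (R : realType) (A B : cstarType R) : Prop :=
  exists f : {linear A -> B},
    [/\ bijective f,
        forall x y, f (cmul x y) = cmul (f x) (f y),
        forall x, f (star x) = star (f x) &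
        forall x, cnorm (f x) = cnorm x].

(* The direct sum of M_{n_0 + 1}, ..., M_{n_k + 1}. *)
Definition matrix_sum (R : realType) (k : nat) (n : 'I_k.+1 -> nat) : cstarType R :=
  bfamily (fun i => mxalg R (n i)).

Definition finite_dimensional (R : realType) (A : cstarType R) : Prop :=
  exists k (n : 'I_k.+1 -> nat), cstar_isomorphic A (matrix_sum R n).

Definition pseudocompact (R : realType) (A : cstarType R) : Prop :=
  exists (J : Type) (U : set_system J) (UU : UltraFilter U)
      (F : J -> cstarType R),
    (forall j, finite_dimensional (F j)) /\
    elementarily_equivalent A (ultraproduct UU F).

Definition pseudomatricial (R : realType) (A : cstarType R) : Prop :=
  exists (J : Type) (U : set_system J) (UU : UltraFilter U) (n : J -> nat),
    elementarily_equivalent A (ultraproduct UU (fun j => mxalg R (n j))).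

Definition is_identity (R : realType) (A : cstarType R) (I : A) : Prop :=
  forall x, cmul I x = x /\ cmul x I = x.

Definition cstar_center (R : realType) (A : cstarType R) : set A :=
  [set z | forall x, cmul z x = cmul x z].
Arguments cstar_center {R} A _.

(* Main.v *)
Require Import Defs.
From mathcomp Require Import all_boot all_order all_algebra.
From mathcomp Require Import complex.
From mathcomp Require Import all_classical all_reals all_analysis.
From mathcomp Require Import ring lra.

Set Implicit Arguments.
Unset Strict Implicit.
Unset Printing Implicit Defensive.

Import Order.TTheory GRing.Theory Num.Theory.
Import numFieldNormedType.Exports.
Import Normc.

Local Open Scope classical_set_scope.
Local Open Scope complex_scope.
Local Open Scope ring_scope.

(** Write [ad_norm a] for the supremum over the unit ball of the norms of the
commutators of [a]. In a matrix algebra, the commutators with matrices of rank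
one show that [a] is within [ad_norm a] of the scalar matrix of its upper left
entry ([mx_dist_scalar]). Working block by block, every element of a
finite-dimensional algebra is within [ad_norm a] of the center. Elementary
equivalence carries these estimates to [A], by the theorem of Los ([los]) for
ultraproducts.

If [A] is equivalent to an ultraproduct of matrix algebras, two kinds of
sentence settle the matter. One says that there is an approximate identity
element; approximate identities form a Cauchy sequence, whose limit is an
identity of [A] ([identity_of_approx]). The other says, for a finite net of
scalars in the unit disc, that every [a] in the unit ball acts by left
multiplication as a scalar of the net, up to [ad_norm a] and the mesh of the
net. For a central [a] the middle error vanishes, so [a] is a limit of scalars,
hence a scalar ([center_scalars]).

Conversely, let [A] be pseudocompact with scalar center. If almost all the
factors [F j] were sums of at least two matrix algebras, the unit of one block
and that of the sum of the others would give, in [A], two elements of norm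
almost one, almost central and with product almost zero. An almost central
element of a general algebra may be far from the center, but the estimate above,
read in [A] and iterated, corrects it to a nearby central one ([central_near]).
The two elements would then be close to scalars of modulus almost one with
product almost zero ([center_not_scalars]). So almost all the [F j] are matrix algebras,
and replacing the others changes no limit along the ultrafilter
([matrix_blocks_pseudomatricial]). *)

Local Notation unit_ball A := [set a : A | cnorm a <= 1].

(** * Suprema over the unit ball and bounds for formulae *)

Lemma extend0 (T : Type) n (v : 'I_n -> T) (a : T) : extend v a ord0 = a.
Proof. by rewrite /extend unlift_none. Qed.

Lemma extend_lift (T : Type) n (v : 'I_n -> T) (a : T) (i : 'I_n) :
  extend v a (lift ord0 i) = v i.
Proof. by rewrite /extend liftK. Qed.

Lemma extend_comp (S T : Type) (f : S -> T) n (v : 'I_n -> S) (a : S) :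
  (fun i => f (extend v a i)) = extend (fun i => f (v i)) (f a).
Proof. by apply/funext => i; rewrite /extend; case: unlift. Qed.

Lemma extend_all (T : Type) (P : T -> Prop) n (v : 'I_n -> T) (a : T) :
  (forall i, P (v i)) -> P a -> forall i, P (extend v a i).
Proof. by move=> Pv Pa i; rewrite /extend; case: unlift. Qed.

Section SupOfRange.
Context {R : realType} (T : Type) (P : set T).
Implicit Types (g : T -> R).

Lemma sup_range_ub g M a : (forall b, P b -> `|g b| <= M) -> P a ->
  g a <= sup [set g b | b in P].
Proof.
move=> gM Pa; apply: ub_le_sup; last by exists a.
by exists M => _ [b Pb <-]; apply: le_trans (gM b Pb); rewrite ler_norm.
Qed.

Lemma sup_range_lt g t : P !=set0 -> t < sup [set g b | b in P] ->
  exists2 a, P a & t < g a.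
Proof.
move=> [b Pb] /sup_gt[]; first by exists (g b), b.
by move=> _ [a Pa <-] ta; exists a.
Qed.

Lemma sup_range_le g t : P !=set0 -> (forall a, P a -> g a <= t) ->
  sup [set g b | b in P] <= t.
Proof.
move=> [b Pb] gt; apply: ge_sup; first by exists (g b), b.
by move=> _ [a Pa <-]; exact: gt.
Qed.

Lemma sup_range_norm g M : P !=set0 -> (forall a, P a -> `|g a| <= M) ->
  `|sup [set g b | b in P]| <= M.
Proof.
move=> P0 gM; rewrite ler_norml; apply/andP; split.
  have [b Pb] := P0; apply: le_trans (sup_range_ub gM Pb).
  by have := gM b Pb; rewrite ler_norml => /andP[].
apply: sup_range_le => // a Pa.
by have := gM a Pa; rewrite ler_norml => /andP[].
Qed.

Lemma inf_rangeE g :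
  inf [set g b | b in P] = - sup [set - g b | b in P].
Proof. by rewrite /inf image_comp. Qed.

End SupOfRange.

Lemma unit_ball0 (R : realType) (A : cstarType R) : unit_ball A !=set0.
Proof. by exists 0 => /=; rewrite cnorm0 ler01. Qed.

Section Boundedness.
Context {R : realType}.

Lemma teval_bounded n (t : term R n) : exists M : R,
  forall (A : cstarType R) (v : 'I_n -> A),
    (forall i, cnorm (v i) <= 1) -> cnorm (teval t v) <= M.
Proof.
elim: t => [i|t [M tM] s [N sN]|c t [M tM]|t [M tM] s [N sN]|t [M tM]].
- by exists 1 => A v; apply.
- exists (M + N) => A v v1 /=; apply: le_trans (cnormD _ _) _.
  by rewrite lerD ?tM ?sN.
- exists (normc c * M) => A v v1 /=.
  by rewrite cnormZ ler_wpM2l ?normc_ge0 ?tM.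
- exists (M * N) => A v v1 /=; apply: le_trans (cnormM _ _) _.
  by rewrite ler_pM ?cnorm_ge0 ?tM ?sN.
- by exists M => A v v1 /=; rewrite cnorm_star tM.
Qed.

(** The bound is uniform over all algebras, so the suprema in the factors of an
ultraproduct and in the ultraproduct itself are bounded together. *)
Lemma feval_bounded n (phi : formula R n) : exists M : R,
  forall (A : cstarType R) (v : 'I_n -> A),
    (forall i, cnorm (v i) <= 1) -> `|feval phi v| <= M.
Proof.
elim: phi => {n} [n t|n k u cu psi /choice[M psiM]|n psi [M psiM]|n psi [M psiM]].
- have [M tM] := teval_bounded t; exists M => A v v1 /=.
  by rewrite ger0_norm ?cnorm_ge0 ?tM.
- pose box := [set r : 'rV[R]_k | forall i, `[- M i, M i]%classic (r ord0 i)].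
  have : bounded_set (u @` box).
    apply: compact_bounded; apply: continuous_compact.
      exact: continuous_subspaceT.
    apply: (@rV_compact R k (fun i => `[- M i, M i]%classic)) => i.
    exact: segment_compact.
  move=> [N [_ /(_ (N + 1))]]; rewrite ltrDl ltr01 => /(_ isT) uN.
  exists (N + 1) => A v v1 /=; apply: uN.
  exists (\row_i feval (psi i) v) => // i.
  by rewrite mxE /= in_itv /= -ler_norml psiM.
- exists M => A v v1 /=; apply: sup_range_norm; first exact: unit_ball0.
  by move=> a a1; apply: psiM; exact: (extend_all (P := fun x => cnorm x <= 1)).
- exists M => A v v1 /=; rewrite inf_rangeE normrN.
  apply: sup_range_norm; first exact: unit_ball0.
  move=> a a1; rewrite normrN; apply: psiM.
  exact: (extend_all (P := fun x => cnorm x <= 1)).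
Qed.

End Boundedness.

(** * Invariance of formulae under isomorphisms *)

Section Isomorphism.
Context {R : realType} (A B : cstarType R) (f : A -> B).
Hypothesis f_surj : forall y, exists x, f x = y.
Hypothesis fD : forall x y, f (x + y) = f x + f y.
Hypothesis fZ : forall c x, f (c *: x) = c *: f x.
Hypothesis fM : forall x y, f (cmul x y) = cmul (f x) (f y).
Hypothesis f_star : forall x, f (star x) = star (f x).
Hypothesis f_norm : forall x, cnorm (f x) = cnorm x.

Lemma teval_morph n (t : term R n) (v : 'I_n -> A) :
  teval t (fun i => f (v i)) = f (teval t v).
Proof.
by elim: t => [|t /= -> s ->|c t /= ->|t /= -> s ->|t /= ->].
Qed.

Lemma feval_morph n (phi : formula R n) (v : 'I_n -> A) :
  feval phi (fun i => f (v i)) = feval phi v.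
Proof.
elim: phi v => {n} [n t|n k u cu psi IH|n psi IH|n psi IH] v /=.
- by rewrite teval_morph f_norm.
- by congr u; apply/rowP => i; rewrite !mxE IH.
- congr sup; apply/seteqP; split => _ [b /= b1 <-].
    have [a fa] := f_surj b; exists a; first by rewrite /= -f_norm fa.
    by rewrite -fa -extend_comp IH.
  by exists (f b); rewrite /= ?f_norm// -extend_comp IH.
- congr inf; apply/seteqP; split => _ [b /= b1 <-].
    have [a fa] := f_surj b; exists a; first by rewrite /= -f_norm fa.
    by rewrite -fa -extend_comp IH.
  by exists (f b); rewrite /= ?f_norm// -extend_comp IH.
Qed.

Lemma sentence_value_morph (phi : sentence R) :
  sentence_value A phi = sentence_value B phi.
Proof.
rewrite /sentence_value -feval_morph; congr feval.
by apply/funext => -[].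
Qed.

End Isomorphism.

(** * The theorem of Los *)

Lemma cvg_row (R : realType) (J : Type) (U : set_system J) (FU : Filter U)
    k (f : J -> 'I_k -> R) (l : 'I_k -> R) :
  (forall i, f j i @[j --> U] --> l i) ->
  (\row_i f j i) @[j --> U] --> \row_i l i.
Proof.
move=> fl; apply/cvg_mx_entourageP => E entE.
rewrite near_map.
suff : \forall j \near U, forall i, (l i, f j i) \in E.
  by apply: filterS => j jE m i; rewrite !mxE.
apply: filter_forall => i; move: (fl i) => /cvg_entourageP/(_ E entE).
by rewrite near_map; apply: filterS => j; rewrite inE.
Qed.

Section Los.
Context {R : realType} {J : Type} (U : set_system J) (UU : UltraFilter U).
Context (F : J -> cstarType R).
Local Notation B := (ultraproduct UU F).

(** A representative of an element of the unit ball may leave the unit ball;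
rescaling the entries of norm above one moves it by a null family. *)
Lemma uclass_lift_ball (x : B) : cnorm x <= 1 ->
  exists2 a : bfamily F, uclass UU a = x & forall j, cnorm (a j) <= 1.
Proof.
move=> x1; pose a := urepr x.
pose r j : R := if cnorm (a j) <= 1 then 1 else (cnorm (a j))^-1.
pose b j := (r j)%:C *: a j.
have rE (s : R) : 0 <= s -> normc s%:C = s.
  by move=> s0; apply: complexI; rewrite normc_norm ger0_norm ?lecR.
have r0 j : 0 <= r j by rewrite /r; case: ifP => // _; rewrite invr_ge0 cnorm_ge0.
have b1 j : cnorm (b j) <= 1.
  rewrite cnormZ rE// /r; case: ifPn => [|]; first by rewrite mul1r.
  rewrite -ltNge => a1; rewrite mulVf//.
  by rewrite gt_eqF// (lt_trans ltr01).
have bP : exists M : R, forall j, cnorm (b j) <= M by exists 1.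
exists (BFamily bP) => //.
rewrite -[x]ureprK; apply/uclass_eqP/ulim_norm_uniq.
have dist j : cnorm ((BFamily bP - urepr x) j) = Num.max 0 (cnorm (a j) - 1).
  have -> : (BFamily bP - urepr x) j = (r j - 1)%:C *: a j.
    by rewrite rmorphB /= scalerBl scale1r.
  rewrite cnormZ /r; case: ifPn => [a1|].
    by rewrite subrr normc0 mul0r max_l// subr_le0.
  rewrite -ltNge => a1; rewrite max_r ?subr_ge0 ?ltW//.
  have a0 : 0 < cnorm (a j) by rewrite (lt_trans ltr01).
  rewrite -opprB rmorphN normcN rE; last by rewrite subr_ge0 invf_le1// ltW.
  by rewrite mulrBl mul1r mulVf// gt_eqF.
apply/cvgrPdist_lt => e e0.
have : \forall j \near U, cnorm (a j) < 1 + e.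
  apply: (cvgr_lt (cnorm x)); first exact: cvg_ulim_norm.
  by rewrite (le_lt_trans x1)// ltrDl.
apply: filterS => j aj; rewrite sub0r normrN dist ger0_norm ?le_max ?lexx//.
by rewrite gt_max e0 ltrBlDl.
Qed.

(** The limit of the suprema is at least the supremum because an almost optimal
element of the ultraproduct lifts to the unit balls, and at most the supremum
because almost optimal elements of the factors assemble into an element of the
ultraproduct. *)
Lemma cvg_sup_ball (g : forall j, F j -> R) (G : B -> R) (M : R) :
  (forall j a, cnorm a <= 1 -> `|g j a| <= M) ->
  (forall x, cnorm x <= 1 -> `|G x| <= M) ->
  (forall a : bfamily F, (forall j, cnorm (a j) <= 1) ->
     g j (a j) @[j --> U] --> G (uclass UU a)) ->
  sup [set g j a | a in unit_ball (F j)] @[j --> U]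
    --> sup [set G x | x in unit_ball B].
Proof.
move=> gM GM gG; set S := sup [set G x | x in _].
apply/cvgrPdist_lt => e e0; have e2 : 0 < e / 2 by rewrite divr_gt0.
have lo : \forall j \near U, S - e < sup [set g j a | a in unit_ball (F j)].
  have [x x1 Sx] : exists2 x, unit_ball B x & S - e < G x.
    by apply: sup_range_lt; [exact: unit_ball0|rewrite ltrBlDr ltrDl].
  have [a ax a1] := uclass_lift_ball x1.
  have : \forall j \near U, S - e < g j (a j).
    by apply: (cvgr_gt (G (uclass UU a))); [exact: gG|rewrite ax].
  apply: filterS => j /lt_le_trans; apply.
  exact: (sup_range_ub (gM j) (a1 j)).
have up : \forall j \near U, sup [set g j a | a in unit_ball (F j)] < S + e.
  have near_sup (j : J) : exists a, unit_ball (F j) a /\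
      sup [set g j a | a in unit_ball (F j)] - e / 2 < g j a.
    have [|a a1 ga] := @sup_range_lt _ _ (unit_ball (F j)) (g j)
      (sup [set g j a | a in unit_ball (F j)] - e / 2) (unit_ball0 _).
      by rewrite ltrBlDr ltrDl.
    by exists a.
  pose a j := projT1 (cid (near_sup j)).
  have Ha j : unit_ball (F j) (a j) /\
      sup [set g j a | a in unit_ball (F j)] - e / 2 < g j (a j).
    by rewrite /a; case: cid.
  have aP : exists M : R, forall j, cnorm (a j) <= M.
    by exists 1 => j; have [] := Ha j.
  have a1 j : cnorm (BFamily aP j) <= 1 by have [] := Ha j.
  have GS : G (uclass UU (BFamily aP)) <= S.
    apply: (sup_range_ub GM) => /=; rewrite cnorm_uclass.
    have := ulim_norm_le UU (BFamily aP); move/le_trans; apply.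
    exact: bfamily_norm_le.
  have : \forall j \near U, g j (a j) < S + e / 2.
    by apply: (cvgr_lt (G (uclass UU (BFamily aP)))); [exact: gG|lra].
  apply: filterS => j; have [_] := Ha j; lra.
apply: filterS2 lo up => j; rewrite ltr_distlC => -> ->//.
Qed.

Lemma los n (phi : formula R n) (v : 'I_n -> bfamily F) :
  (forall i j, cnorm (v i j) <= 1) ->
  feval phi (fun i => v i j) @[j --> U] --> feval phi (fun i => uclass UU (v i)).
Proof.
have class1 (a : bfamily F) : (forall j, cnorm (a j) <= 1) ->
    cnorm (uclass UU a) <= 1.
  move=> a1; rewrite cnorm_uclass; have := ulim_norm_le UU a.
  by move/le_trans; apply; exact: bfamily_norm_le.
elim: phi v => {n} [n t|n k u cu psi IH|n psi IH|n psi IH] v v1.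
- have -> : feval (FNorm t) (fun i => uclass UU (v i)) =
      ulim_norm U (teval t v : bfamily F).
    rewrite /= -[RHS](cnorm_uclass UU); congr cnorm.
    elim: t => [|t /= -> s ->|c t /= ->|t /= -> s ->|t /= ->] //.
    + by rewrite -uclassD.
    + by rewrite -uclass_scale.
    + exact/esym/uclassM.
    + exact/esym/uclass_star.
  have E j : feval (FNorm t) (fun i => v i j) = cnorm ((teval t v : bfamily F) j).
    by congr cnorm; elim: t => [|t /= -> s ->|c t /= ->|t /= -> s ->|t /= ->].
  by under eq_fun do rewrite E; exact: cvg_ulim_norm.
- apply: (@cvg_comp _ _ _ (fun j => \row_i feval (psi i) (fun m => v m j)) u).
    by apply: cvg_row => i; exact: IH.
  exact: cu.
- have [M psiM] := feval_bounded psi.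
  apply: (@cvg_sup_ball (fun j a => feval psi (extend (fun i => v i j) a)) _ M).
  + move=> j a a1; apply: psiM.
    exact: (extend_all (P := fun x => cnorm x <= 1)).
  + move=> x x1; apply: psiM.
    apply: (extend_all (P := fun x => cnorm x <= 1)) => // i.
    exact: class1.
  + move=> a a1; rewrite -extend_comp.
    under eq_fun do rewrite -(extend_comp (fun b : bfamily F => b _)).
    apply: IH => i j.
    exact: (extend_all (P := fun x : bfamily F => cnorm (x j) <= 1)).
- have [M psiM] := feval_bounded psi.
  rewrite /= inf_rangeE; under eq_fun do rewrite inf_rangeE.
  apply: cvgN.
  apply: (@cvg_sup_ball (fun j a => - feval psi (extend (fun i => v i j) a))
    (fun a => - feval psi (extend (fun i => uclass UU (v i)) a)) M).
  + move=> j a a1; rewrite normrN; apply: psiM.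
    exact: (extend_all (P := fun x => cnorm x <= 1)).
  + move=> x x1; rewrite normrN; apply: psiM.
    apply: (extend_all (P := fun x => cnorm x <= 1)) => // i.
    exact: class1.
  + move=> a a1; apply: cvgN; rewrite -extend_comp.
    under eq_fun do rewrite -(extend_comp (fun b : bfamily F => b _)).
    apply: IH => i j.
    exact: (extend_all (P := fun x : bfamily F => cnorm (x j) <= 1)).
Qed.

Lemma los_sentence (phi : sentence R) :
  sentence_value (F j) phi @[j --> U] --> sentence_value B phi.
Proof.
have E (a : 'I_0 -> B) : feval phi a = sentence_value B phi.
  by congr feval; apply/funext => -[].
by rewrite -(E (fun=> uclass UU 0)); apply: (@los 0 phi (fun=> 0)) => -[].
Qed.

Lemma sentence_value_le (A : cstarType R) (phi : sentence R) (t : R) :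
  elementarily_equivalent A B ->
  (\forall j \near U, sentence_value (F j) phi <= t) ->
  sentence_value A phi <= t.
Proof.
move=> AB phit; rewrite AB leNgt; apply/negP => tphi.
have tU : \forall j \near U, t < sentence_value (F j) phi.
  by apply: (cvgr_gt (sentence_value B phi)) => //; exact: los_sentence.
have [j [/= /lt_le_trans h /h]] := filter_ex (filterI tU phit).
by rewrite ltxx.
Qed.

End Los.

(** * Connectives and quantifiers *)

Section Connectives.
Context {R : realType} (n : nat).
Implicit Types (phi psi : formula R n) (t s : term R n).

Definition tsub t s : term R n := TAdd t (TScale (- 1) s).

Definition fpair phi psi (i : 'I_2) := if i == ord0 then phi else psi.

Let coord2 (i : 'I_2) : continuous (fun r : 'rV[R]_2 => r ord0 i).
Proof. exact: coord_continuous. Qed.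

Let sub_continuous :
  continuous (fun r : 'rV[R]_2 => r ord0 ord0 - r ord0 ord_max).
Proof. move=> r; exact (cvgB (@coord2 ord0 r) (@coord2 ord_max r)). Qed.

Let max_continuous2 :
  continuous (fun r : 'rV[R]_2 => Num.max (r ord0 ord0) (r ord0 ord_max)).
Proof. by apply: max_fun_continuous; exact: coord2. Qed.

Let min_continuous2 :
  continuous (fun r : 'rV[R]_2 => Num.min (r ord0 ord0) (r ord0 ord_max)).
Proof. by apply: min_fun_continuous; exact: coord2. Qed.

Let onem_continuous : continuous (fun r : 'rV[R]_1 => 1 - r ord0 ord0).
Proof.
move=> r.
exact (cvgB (@cst_continuous _ _ (1 : R) r) (@coord_continuous _ 1 1 ord0 ord0 r)).
Qed.

Definition fonem phi : formula R n := FConn onem_continuous (fun=> phi).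
Definition fsub phi psi : formula R n := FConn sub_continuous (fpair phi psi).
Definition fmax phi psi : formula R n := FConn max_continuous2 (fpair phi psi).
Definition fmin phi psi : formula R n := FConn min_continuous2 (fpair phi psi).

Lemma feval_sub (A : cstarType R) phi psi (v : 'I_n -> A) :
  feval (fsub phi psi) v = feval phi v - feval psi v.
Proof. by rewrite /= !mxE. Qed.

Lemma feval_onem (A : cstarType R) phi (v : 'I_n -> A) :
  feval (fonem phi) v = 1 - feval phi v.
Proof. by rewrite /= !mxE. Qed.

Lemma feval_max (A : cstarType R) phi psi (v : 'I_n -> A) :
  feval (fmax phi psi) v = Num.max (feval phi v) (feval psi v).
Proof. by rewrite /= !mxE. Qed.

Lemma feval_min (A : cstarType R) phi psi (v : 'I_n -> A) :
  feval (fmin phi psi) v = Num.min (feval phi v) (feval psi v).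
Proof. by rewrite /= !mxE. Qed.

End Connectives.

Section Quantifiers.
Context {R : realType} (A : cstarType R) (n : nat).
Implicit Types (psi : formula R n.+1) (v : 'I_n -> A).

Let feval_ball_bounded psi v : (forall i, cnorm (v i) <= 1) ->
  exists M, forall a : A, cnorm a <= 1 -> `|feval psi (extend v a)| <= M.
Proof.
move=> v1; have [M psiM] := feval_bounded psi; exists M => a a1.
by apply: psiM; exact: (extend_all (P := fun x => cnorm x <= 1)).
Qed.

Lemma feval_sup_le psi v t :
  (forall a : A, cnorm a <= 1 -> feval psi (extend v a) <= t) ->
  feval (FSup psi) v <= t.
Proof. exact: sup_range_le (unit_ball0 A). Qed.

Lemma feval_sup_ge psi v (a : A) : (forall i, cnorm (v i) <= 1) ->
  cnorm a <= 1 -> feval psi (extend v a) <= feval (FSup psi) v.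
Proof.
move=> /feval_ball_bounded -/(_ psi)[M psiM] a1.
exact: (sup_range_ub psiM a1).
Qed.

Lemma feval_inf_le psi v (a : A) : (forall i, cnorm (v i) <= 1) ->
  cnorm a <= 1 -> feval (FInf psi) v <= feval psi (extend v a).
Proof.
move=> /feval_ball_bounded -/(_ psi)[M psiM] a1.
rewrite /= inf_rangeE lerNl.
by apply: (@sup_range_ub _ _ (unit_ball A) _ M) => // b b1; rewrite normrN psiM.
Qed.

Lemma feval_inf_lt psi v t : feval (FInf psi) v < t ->
  exists2 a : A, cnorm a <= 1 & feval psi (extend v a) < t.
Proof.
rewrite /= inf_rangeE ltrNl => /(sup_range_lt (unit_ball0 A))[a a1].
by rewrite ltrN2 => psit; exists a.
Qed.

End Quantifiers.

(** * Commutators *)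

Section Commutator.
Context {R : realType}.

(** The norm of the inner derivation of [a]; it vanishes exactly when [a] is
central. *)
Definition ad_norm (A : cstarType R) (a : A) : R :=
  sup [set cnorm (cmul a x - cmul x a) | x in unit_ball A].

Section AdNorm.
Context (A : cstarType R).
Implicit Types (a x : A).

Lemma cmulBl x y z : cmul (x - y) z = cmul x z - cmul y z :> A.
Proof. by rewrite cmulDl -scaleN1r -cscalerAl scaleN1r. Qed.

Lemma cmulBr x y z : cmul z (x - y) = cmul z x - cmul z y :> A.
Proof. by rewrite cmulDr -scaleN1r -cscalerAr scaleN1r. Qed.

Lemma cnormB x y : cnorm (x - y) <= cnorm x + cnorm y :> R.
Proof. by apply: le_trans (cnormD (x : A) _) _; rewrite cnormN. Qed.

Lemma normc_real (s : R) : 0 <= s -> normc s%:C = s.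
Proof. by move=> s0; apply: complexI; rewrite normc_norm ger0_norm ?lecR. Qed.

Let ad_bounded a x : cnorm x <= 1 ->
  `|cnorm (cmul a x - cmul x a)| <= cnorm a + cnorm a.
Proof.
move=> x1; rewrite ger0_norm ?cnorm_ge0//; apply: le_trans (cnormB _ _) _.
by rewrite lerD// (le_trans (cnormM _ _))//; [rewrite ler_piMr|rewrite ler_piMl];
  rewrite ?cnorm_ge0.
Qed.

Lemma ad_norm_le a t :
  (forall x, cnorm x <= 1 -> cnorm (cmul a x - cmul x a) <= t) -> ad_norm a <= t.
Proof. exact: sup_range_le (unit_ball0 A). Qed.

Lemma ad_norm_ge0 a : 0 <= ad_norm a.
Proof.
have x1 : cnorm (0 : A) <= 1 by rewrite cnorm0 ler01.
exact: le_trans (cnorm_ge0 _) (sup_range_ub (@ad_bounded a) x1).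
Qed.

Lemma le_ad_norm a x : cnorm (cmul a x - cmul x a) <= ad_norm a * cnorm x.
Proof.
have [x0|x0] := eqVneq (cnorm x) 0.
  move/cnorm0_eq0: x0 => ->.
  rewrite cnorm0 mulr0 -(scale0r 0) -cscalerAl -cscalerAr !scale0r subr0.
  by rewrite cnorm0.
have xp : 0 < cnorm x by rewrite lt0r x0 cnorm_ge0.
have xE : x = (cnorm x)%:C *: ((cnorm x)^-1%:C *: x).
  by rewrite scalerA -rmorphM /= mulfV// scale1r.
have y1 : cnorm ((cnorm x)^-1%:C *: x) <= 1.
  by rewrite cnormZ normc_real ?invr_ge0 ?cnorm_ge0// mulVf.
rewrite [X in cmul a X]xE [X in cmul X a]xE -cscalerAl -cscalerAr -scalerBr.
rewrite cnormZ normc_real ?cnorm_ge0// mulrC ler_wpM2r ?cnorm_ge0//.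
exact: (sup_range_ub (@ad_bounded a) y1).
Qed.

End AdNorm.

Definition fad n (i : 'I_n) : formula R n :=
  FSup (FNorm (tsub (TMul (TVar R (lift ord0 i)) (TVar R ord0))
                    (TMul (TVar R ord0) (TVar R (lift ord0 i))))).

Lemma feval_ad (A : cstarType R) n (i : 'I_n) (v : 'I_n -> A) :
  feval (fad i) v = ad_norm (v i).
Proof.
congr sup; apply: eq_imagel => x x1 /=.
by rewrite extend0 extend_lift scaleN1r.
Qed.

End Commutator.

(** * The sentences that separate the two classes *)

Section Sentences.
Context {R : realType}.
(* Below two quantifiers, [old] is the variable of the outer one and [new] that
   of the inner one. *)
Local Notation new := (TVar R ord0).
Local Notation old := (TVar R (lift ord0 ord0)).

Definition has_unit_sentence : sentence R :=
  FInf (FSup (fmax (FNorm (tsub (TMul old new) new))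
                   (FNorm (tsub (TMul new old) new)))).

(** Nonpositive when every [a] of the unit ball is within [ad_norm a] of a central
element of the unit ball; conversely, by [central_near], a nonpositive value
bounds the distance of [a] to the center by a multiple of [ad_norm a], up to an
arbitrarily small error. *)
Definition center_dist_sentence : sentence R :=
  FSup (FInf (fmax (fsub (FNorm (tsub old new)) (fad (lift ord0 ord0)))
                   (fad ord0))).

(** Small values mean that some two elements of norm almost one are almost central
and have product almost zero, as the units of two complementary direct summands
do. *)
Definition decomposable_sentence : sentence R :=
  FInf (FInf (fmax (fmax (fad ord0) (fad (lift ord0 ord0)))
    (fmax (FNorm (TMul old new))
          (fmax (fonem (FNorm old)) (fonem (FNorm new)))))).

(** The least distance, in operator norm, from left multiplication by the
variable to a scalar of [0 :: L]. Acting on the unit ball replaces the identity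
element, which is not a term of the language; the scalar [0] makes the minimum
one over a nonempty list. *)
Definition fscalar_dist (L : seq R[i]) : formula R 1 :=
  foldr (fun c => fmin
      (FSup (FNorm (tsub (TMul old new) (TScale c new)))))
    (FSup (FNorm (tsub (TMul old new) (TScale 0 new)))) L.

(** When [L] is a fine net of the unit disc, a small value forces the central
elements of the unit ball to be almost scalar. *)
Definition scalar_sentence (L : seq R[i]) : sentence R :=
  FSup (fsub (fscalar_dist L) (fad ord0)).

Context (A : cstarType R).

Let ball0 (T : 'I_0 -> A) : forall i, cnorm (T i) <= 1.
Proof. by case. Qed.

Let ball1 (a : A) : cnorm a <= 1 ->
  forall i, cnorm (extend (fun i : 'I_0 => 0) a i) <= 1.
Proof. by move=> a1; apply: (extend_all (P := fun x => cnorm x <= 1)) => // -[]. Qed.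

Lemma has_unit_sentence_le (t : R) (e : A) : cnorm e <= 1 ->
  (forall x : A, cnorm x <= 1 -> cnorm (cmul e x - x) <= t /\
                             cnorm (cmul x e - x) <= t) ->
  sentence_value A has_unit_sentence <= t.
Proof.
move=> e1 et; apply: le_trans (feval_inf_le _ (ball0 _) e1) _.
apply: feval_sup_le => x /et[ext xet]; rewrite feval_max ge_max.
by rewrite /= !scaleN1r extend_lift !extend0 ext.
Qed.

Lemma has_unit_sentence_lt (t : R) : sentence_value A has_unit_sentence < t ->
  exists2 e : A, cnorm e <= 1 & forall x : A, cnorm x <= 1 ->
    cnorm (cmul e x - x) < t /\ cnorm (cmul x e - x) < t.
Proof.
rewrite /sentence_value => /feval_inf_lt[e e1 et]; exists e => // x x1.
have := le_lt_trans (feval_sup_ge _ (ball1 e1) x1) et.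
rewrite feval_max gt_max /= !scaleN1r extend_lift !extend0.
by move=> /andP[].
Qed.

Lemma center_dist_sentence_le (t : R) :
  (forall a : A, cnorm a <= 1 -> exists2 z : A, cnorm z <= 1 &
     cnorm (a - z) - ad_norm a <= t /\ ad_norm z <= t) ->
  sentence_value A center_dist_sentence <= t.
Proof.
move=> At; apply: feval_sup_le => a a1; have [z z1 [azt zt]] := At a a1.
apply: le_trans (feval_inf_le _ (ball1 a1) z1) _.
rewrite feval_max ge_max feval_sub !feval_ad /= !scaleN1r.
by rewrite !extend_lift !extend0 azt zt.
Qed.

Lemma center_dist_sentence_lt (t : R) (a : A) :
  sentence_value A center_dist_sentence < t -> cnorm a <= 1 ->
  exists2 z : A, cnorm z <= 1 & cnorm (a - z) - ad_norm a < t /\ ad_norm z < t.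
Proof.
rewrite /sentence_value => At a1.
have /feval_inf_lt[z z1] := le_lt_trans (feval_sup_ge _ (ball0 _) a1) At.
rewrite feval_max gt_max feval_sub !feval_ad /= !scaleN1r.
by rewrite !extend_lift !extend0 => /andP[]; exists z.
Qed.

Lemma decomposable_sentence_le (t : R) (p q : A) :
  cnorm p <= 1 -> cnorm q <= 1 -> ad_norm p <= t -> ad_norm q <= t ->
  cnorm (cmul p q) <= t -> 1 - cnorm p <= t -> 1 - cnorm q <= t ->
  sentence_value A decomposable_sentence <= t.
Proof.
move=> p1 q1 pt qt pqt pt' qt'.
apply: le_trans (feval_inf_le _ (ball0 _) p1) _.
apply: le_trans (feval_inf_le _ (ball1 p1) q1) _.
rewrite !feval_max !ge_max !feval_ad !feval_onem /=.
by rewrite !extend_lift !extend0 pt qt pqt pt' qt'.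
Qed.

Lemma decomposable_sentence_lt (t : R) :
  sentence_value A decomposable_sentence < t ->
  exists p q : A, [/\ cnorm p <= 1, cnorm q <= 1, ad_norm p < t & ad_norm q < t] /\
    [/\ cnorm (cmul p q) < t, 1 - cnorm p < t & 1 - cnorm q < t].
Proof.
rewrite /sentence_value => /feval_inf_lt[p p1 /feval_inf_lt[q q1]].
rewrite !feval_max !gt_max !feval_ad !feval_onem /= !extend_lift !extend0.
by move=> /andP[/andP[? ?] /and3P[]]; exists p, q.
Qed.

Lemma fscalar_distP (L : seq R[i]) (a : A) (t : R) : cnorm a <= 1 ->
  feval (fscalar_dist L) (extend (fun i : 'I_0 => 0) a) <= t <->
  exists2 c, c \in 0 :: L &
    forall x : A, cnorm x <= 1 -> cnorm (cmul a x - c *: x) <= t.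
Proof.
move=> a1.
have distP (c : R[i]) : feval (FSup (FNorm (tsub (TMul old new) (TScale c new))))
      (extend (fun i : 'I_0 => 0) a) <= t <->
    forall x : A, cnorm x <= 1 -> cnorm (cmul a x - c *: x) <= t.
  split=> [at_ x x1|at_].
    have := le_trans (feval_sup_ge _ (ball1 a1) x1) at_.
    by rewrite /= scaleN1r extend_lift !extend0.
  by apply: feval_sup_le => x /at_; rewrite /= scaleN1r extend_lift !extend0.
elim: L => [|c L IH].
  rewrite distP; split=> [?|[c]]; first by exists 0; rewrite ?mem_head.
  by rewrite inE => /eqP ->.
rewrite [fscalar_dist _]/= feval_min ge_min; split=> [/orP[/distP ?|/IH[d]]|].
- by exists c => //; rewrite !inE eqxx orbT.
- by rewrite inE => dL ?; exists d => //; rewrite !inE; case/orP: dL => ->;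
    rewrite ?orbT.
move=> [d dL dt]; apply/orP; move: dL; rewrite !inE.
case/or3P => [/eqP d0|/eqP dc|dL].
- by right; apply/IH; exists d; rewrite // d0 mem_head.
- by left; apply/distP; rewrite -dc.
- by right; apply/IH; exists d; rewrite // inE dL orbT.
Qed.

Lemma scalar_sentence_le (L : seq R[i]) (t : R) :
  (forall a : A, cnorm a <= 1 -> exists2 c, c \in 0 :: L &
     forall x : A, cnorm x <= 1 -> cnorm (cmul a x - c *: x) <= t + ad_norm a) ->
  sentence_value A (scalar_sentence L) <= t.
Proof.
move=> At; apply: feval_sup_le => a a1.
rewrite feval_sub feval_ad extend0 lerBlDr.
by apply/fscalar_distP => //; exact: At.
Qed.

Lemma le_scalar_sentence (L : seq R[i]) (a : A) (t : R) :
  sentence_value A (scalar_sentence L) <= t -> cnorm a <= 1 ->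
  exists c, forall x : A, cnorm x <= 1 -> cnorm (cmul a x - c *: x) <= t + ad_norm a.
Proof.
rewrite /sentence_value => At a1.
have := le_trans (feval_sup_ge _ (ball0 _) a1) At.
rewrite feval_sub feval_ad extend0 lerBlDr => /fscalar_distP -/(_ a1)[c _ ?].
by exists c.
Qed.

End Sentences.

(** * Exact elements from approximate ones *)

Section Completeness.
Context {R : realType}.

Lemma half_expn_small (C e : R) : 0 < e -> exists n, C * 2^-1 ^+ n < e.
Proof.
move=> e0; have C1 : 0 < `|C| + 1 by rewrite ltr_wpDl.
have : 2^-1 ^+ n @[n --> \oo] --> (0 : R).
  by apply: cvg_expr; rewrite ger0_norm ?invf_lt1 ?ltr1n.
move=> /cvgrPdist_lt/(_ _ (divr_gt0 e0 C1))[N _ /(_ N (leqnn N))] /=.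
have hN : 0 <= 2^-1 ^+ N :> R by rewrite exprn_ge0// invr_ge0.
rewrite sub0r normrN ger0_norm// ltr_pdivlMr// mulrC => /(le_lt_trans _) h.
by exists N; apply: h; rewrite ler_wpM2r// (le_trans (ler_norm _))// lerDl.
Qed.

Lemma half_expn_gt0 n : 0 < 2^-1 ^+ n :> R.
Proof. by rewrite exprn_gt0// invr_gt0. Qed.

Lemma half_expn_le m n : (m <= n)%N -> 2^-1 ^+ n <= 2^-1 ^+ m :> R.
Proof. by move=> mn; rewrite ler_wiXn2l// ?invr_ge0// invf_le1 ?ler1n. Qed.

Context {A : cstarType R}.
Implicit Types (x y z : A).

Lemma cnorm_dist_trans y x z : cnorm (x - z) <= cnorm (x - y) + cnorm (y - z).
Proof. by have := cnormD (x - y) (y - z); rewrite addrA subrK. Qed.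

Lemma cnorm_distC x y : cnorm (x - y) = cnorm (y - x).
Proof. by rewrite -cnormN opprB. Qed.

Lemma cnorm_small_eq0 x : (forall e : R, 0 < e -> cnorm x <= e) -> x = 0.
Proof.
move=> xe; apply: cnorm0_eq0; apply/eqP; rewrite eq_le cnorm_ge0 andbT.
by apply/ler_addgt0Pr => e e0; rewrite add0r xe.
Qed.

Lemma geometric_cauchy_cvg (u : nat -> A) (C : R) :
  (forall n m, (n <= m)%N -> cnorm (u m - u n) <= C * 2^-1 ^+ n) ->
  exists l, forall n, cnorm (l - u n) <= C * 2^-1 ^+ n.
Proof.
move=> uC.
have [e e0|l ul] := @cnorm_complete _ _ u.
  have [N NC] := half_expn_small (2 * C) e0; exists N => m n Nm Nn.
  apply: le_lt_trans (cnorm_dist_trans (u N) _ _) _.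
  rewrite [cnorm (u N - _)]cnorm_distC; have := uC _ _ Nm; have := uC _ _ Nn.
  by lra.
exists l => n; apply/ler_addgt0Pr => e /ul[N HN].
have Nm := HN (maxn N n) (leq_maxl _ _); have nm := uC n (maxn N n) (leq_maxr _ _).
apply: le_trans (cnorm_dist_trans (u (maxn N n)) _ _) _.
by lra.
Qed.

Lemma scale_unit_ball x : exists c y, [/\ c != 0, cnorm y <= 1 & x = c *: y].
Proof.
have r0 : 0 < cnorm x + 1 by rewrite ltr_wpDl ?cnorm_ge0.
exists (cnorm x + 1)%:C, ((cnorm x + 1)^-1%:C *: x); split.
- by rewrite fmorph_eq0 gt_eqF.
- rewrite cnormZ normc_real ?invr_ge0; last by rewrite ltW.
  rewrite ler_pdivrMl// mulr1.
  by rewrite lerDl ler01.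
- by rewrite scalerA -rmorphM /= mulfV ?scale1r// gt_eqF.
Qed.

End Completeness.

Section CenterDistance.
Context {R : realType} (A : cstarType R).

(** Two approximate identities [e] and [f] are close, both being close to
[e f]. *)
Lemma identity_of_approx :
  (forall t : R, 0 < t -> exists2 e : A, cnorm e <= 1 &
     forall x : A, cnorm x <= 1 -> cnorm (cmul e x - x) < t /\
                                  cnorm (cmul x e - x) < t) ->
  exists I : A, is_identity I.
Proof.
move=> At.
have /choice[e He] n : exists e : A, cnorm e <= 1 /\
     forall x : A, cnorm x <= 1 -> cnorm (cmul e x - x) < 2^-1 ^+ n /\
                                  cnorm (cmul x e - x) < 2^-1 ^+ n.
  by have [e e1 He] := At _ (half_expn_gt0 n); exists e.
have [n m nm|I eI] := @geometric_cauchy_cvg _ _ e 2.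
  apply: le_trans (cnorm_dist_trans (cmul (e m) (e n)) _ _) _.
  have [_ /(_ _ (He n).1)[+ _]] := He m.
  have [_ /(_ _ (He m).1)[_ +]] := He n.
  have := @half_expn_le R _ _ nm.
  rewrite [cnorm (e m - _)]cnorm_distC; lra.
exists I.
suff unit x : cnorm x <= 1 -> cmul I x = x /\ cmul x I = x.
  move=> x; have [c [y [_ /unit[Iy yI] ->]]] := scale_unit_ball x.
  by rewrite -cscalerAr -cscalerAl Iy yI.
move=> x1; split; apply/eqP; rewrite -subr_eq0; apply/eqP.
  apply: cnorm_small_eq0 => t /(half_expn_small 3)[n tn].
  apply: le_trans (cnorm_dist_trans (cmul (e n) x) _ _) _.
  have [_ /(_ _ x1)[+ _]] := He n; rewrite -cmulBl.
  have : cnorm (cmul (I - e n) x) <= 2 * 2^-1 ^+ n.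
    by apply: le_trans (cnormM _ _) _; rewrite (le_trans _ (eI n))// ler_piMr ?cnorm_ge0.
  by lra.
apply: cnorm_small_eq0 => t /(half_expn_small 3)[n tn].
apply: le_trans (cnorm_dist_trans (cmul x (e n)) _ _) _.
have [_ /(_ _ x1)[_ +]] := He n; rewrite -cmulBr.
have : cnorm (cmul x (I - e n)) <= 2 * 2^-1 ^+ n.
  by apply: le_trans (cnormM _ _) _; rewrite (le_trans _ (eI n))// ler_piMl ?cnorm_ge0.
by lra.
Qed.

(** The sentence replaces [a] by an element as close to it as [ad_norm a] allows,
with as small an [ad_norm] as desired. Iterating with geometrically decreasing
tolerances gives a Cauchy sequence, whose limit is central. *)
Lemma central_near (a : A) (t : R) :
  sentence_value A center_dist_sentence <= 0 ->
  cnorm a <= 1 -> ad_norm a < t ->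
  exists2 z : A, cstar_center A z & cnorm (a - z) <= 4 * t.
Proof.
move=> A0 a1 at_; have t0 : 0 < t := le_lt_trans (ad_norm_ge0 a) at_.
(* One correction step, totalized by [0] outside its domain. *)
have /choice[f Hf] (p : A * R) : exists z : A, cnorm p.1 <= 1 -> 0 < p.2 ->
    [/\ cnorm z <= 1, cnorm (p.1 - z) < ad_norm p.1 + p.2 & ad_norm z < p.2].
  case: p => b s /=.
  have [s0|s0] := ltP 0 s; last by exists 0.
  have [b1|b1] := leP (cnorm b) 1; last by exists 0.
  have [z z1 [bz zs]] := center_dist_sentence_lt (le_lt_trans A0 s0) b1.
  by exists z => _ _; split=> //; rewrite -ltrBlDl.
pose h n := t * 2^-1 ^+ n.
have h0 n : 0 < h n by rewrite mulr_gt0 ?half_expn_gt0.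
pose u := fix u n := if n is m.+1 then f (u m, h n) else a.
have hu n : cnorm (u n) <= 1 /\ ad_norm (u n) < h n.
  elim: n => [|n [IH _]] /=; first by rewrite /h expr0 mulr1.
  by have [] := Hf (u n, h n.+1) IH (h0 _).
have step n : cnorm (u n.+1 - u n) <= 2 * h n.
  have [un1 uh] := hu n.
  have [_ /= + _] := Hf (u n, h n.+1) un1 (h0 _).
  have : h n.+1 <= h n by apply: ler_wpM2l; [exact: ltW|exact: half_expn_le].
  by rewrite cnorm_distC; lra.
(* The steps are bounded by [2 * h n], so their sum telescopes. *)
have dist n k : cnorm (u (n + k)%N - u n) <= 4 * h n - 4 * h (n + k)%N.
  elim: k => [|k IH]; first by rewrite addn0 !subrr cnorm0.
  rewrite addnS; apply: le_trans (cnorm_dist_trans (u (n + k)%N) _ _) _.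
  have := step (n + k)%N.
  rewrite (_ : h (n + k).+1 = h (n + k)%N / 2); first by lra.
  by rewrite /h exprS mulrCA mulrC.
have [n m nm|z uz] := @geometric_cauchy_cvg _ _ u (4 * t).
  by have := dist n (m - n)%N; rewrite subnKC// -mulrA; have := h0 m; rewrite /h; lra.
exists z; last by have := uz 0; rewrite expr0 mulr1 cnorm_distC.
move=> x; apply/eqP; rewrite -subr_eq0; apply/eqP.
(* Up to the factor [2^-1 ^+ n], the distance from [u n] to the limit is at most
   [4 * t] and counts twice in the commutator, and [ad_norm (u n)] is at most
   [t]; hence [9 * t]. *)
apply: cnorm_small_eq0 => e /(half_expn_small (9 * t * cnorm x))[n].
set H := 2^-1 ^+ n => ne.
have -> : cmul z x - cmul x z =
    (cmul (z - u n) x - cmul x (z - u n)) + (cmul (u n) x - cmul x (u n)).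
  rewrite cmulBl cmulBr; move: (cmul z x) (cmul (u n) x) => p q.
  by rewrite opprB addrAC [p - q + _]addrA subrK addrA subrK.
apply: le_trans (cnormD _ _) _; apply: le_trans (lerD (cnormB _ _) (le_ad_norm _ _)) _.
have zu : cnorm (z - u n) * cnorm x <= 4 * t * H * cnorm x.
  by rewrite ler_wpM2r ?cnorm_ge0.
have un : ad_norm (u n) * cnorm x <= t * H * cnorm x.
  by rewrite ler_wpM2r ?cnorm_ge0// ltW//; have [] := hu n.
have := cnormM (z - u n) x; have := cnormM x (z - u n).
rewrite [cnorm x * _]mulrC; move: zu un ne.
rewrite ![_ * cnorm x]mulrC; set X := cnorm x.
rewrite (_ : 9 * t = t * 9) 1?mulrC// -!mulrA.
have -> : X * (t * (9 * H)) = 9 * (X * (t * H)) by ring.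
have -> : X * (4 * (t * H)) = 4 * (X * (t * H)) by ring.
by lra.
Qed.

End CenterDistance.

(** * Matrix algebras and their direct sums *)

Section Matrices.
Context {R : realType} (n : nat).
Local Notation M := (mxalg R n).

Definition mxscalar (c : R[i]) : M := (c%:M : 'M[R[i]]_n.+1).

Lemma cnorm_mx (a : M) : cnorm a = opnorm a.
Proof. by []. Qed.

Lemma cnorm_mxscalar c : cnorm (mxscalar c) = normc c.
Proof.
apply/eqP; rewrite eq_le cnorm_mx; apply/andP; split.
  apply: opnorm_le => [|x]; first exact: normc_ge0.
  by rewrite mul_scalar_mx vnormZ.
by apply: le_trans (opnorm_coord _ ord0 ord0); rewrite mxE eqxx.
Qed.

Lemma mxscalar_mull c (a : M) : cmul (mxscalar c) a = c *: a.
Proof. exact: mul_scalar_mx. Qed.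

Lemma mxscalar_mulr c (a : M) : cmul a (mxscalar c) = c *: a.
Proof. exact: mul_mx_scalar. Qed.

(** With [x] the rank one matrix sending the first basis vector [e] to [y], the
vector [(a x - x a) e] equals [(a - c) y] for [c] the upper left entry of
[a]. *)
Lemma mx_dist_scalar (a : M) (t : R) : 0 <= t ->
  (forall x : M, cnorm (cmul a x - cmul x a) <= t * cnorm x) ->
  cnorm (a - mxscalar (a ord0 ord0)) <= t.
Proof.
move=> t0 at_; rewrite cnorm_mx; apply: opnorm_le => // y.
pose e : 'cV[R[i]]_n.+1 := delta_mx ord0 0.
pose x : M := y *m (delta_mx 0 ord0 : 'rV[R[i]]_n.+1).
have xnorm : cnorm x <= vnorm y.
  rewrite cnorm_mx; apply: opnorm_le => [|z]; first exact: vnorm_ge0.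
  rewrite /x -mulmxA; set s := _ *m z.
  have -> : y *m s = s 0 0 *: y.
    by rewrite {1}[s]mx11_scalar mul_mx_scalar.
  rewrite vnormZ mulrC ler_wpM2l ?vnorm_ge0//.
  by rewrite /s -rowE mxE vnorm_coord.
have xe : x *m e = y.
  rewrite /x /e -mulmxA mul_delta_mx.
  by rewrite (_ : delta_mx 0 0 = 1%:M) ?mulmx1// [RHS]mx11_scalar;
    apply/matrixP => i j; rewrite !mxE !ord1.
have -> : (a - mxscalar (a ord0 ord0)) *m y = (cmul a x - cmul x a) *m e.
  rewrite !mulmxBl -[cmul a x *m e]mulmxA xe; congr (_ - _).
  rewrite mul_scalar_mx -[cmul x a *m e]mulmxA /x -mulmxA.
  set s := _ *m (a *m e); rewrite [s]mx11_scalar mul_mx_scalar.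
  by congr (_ *: _); rewrite /s mulmxA -rowE -colE !mxE.
apply: le_trans (opnorm_mulmx _ _) _.
have := vnorm_delta (R := R) (ord0 : 'I_n.+1).
rewrite -/e => e1; apply: le_trans (_ : t * cnorm x <= _); last by rewrite ler_wpM2l.
by apply: le_trans (at_ x); rewrite cnorm_mx ler_piMr ?opnorm_ge0.
Qed.

Lemma normc_entry_le (a : M) i j : normc (a i j) <= cnorm a.
Proof. exact: opnorm_coord. Qed.

End Matrices.

Section Blocks.
Context {R : realType} (k : nat) (n : 'I_k.+1 -> nat).
Local Notation S := (matrix_sum R n).

Definition scalar_blocks (c : 'I_k.+1 -> R[i]) (i : 'I_k.+1) : mxalg R (n i) :=
  mxscalar (n i) (c i).

Lemma scalar_blocks_bounded (c : 'I_k.+1 -> R[i]) (t : R) :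
  (forall i, normc (c i) <= t) -> exists M : R, forall i, cnorm (scalar_blocks c i) <= M.
Proof. by move=> ct; exists t => i; rewrite cnorm_mxscalar. Qed.

Definition diag_blocks c t (ct : forall i, normc (c i) <= t) : S :=
  BFamily (scalar_blocks_bounded ct).

Lemma diag_blocks_norm c t (ct : forall i, normc (c i) <= t) :
  0 <= t -> cnorm (diag_blocks ct) <= t.
Proof.
by move=> t0; apply: bfamily_norm_le => // i; rewrite cnorm_mxscalar.
Qed.

Lemma diag_blocks_norm_ge c t (ct : forall i, normc (c i) <= t) i :
  normc (c i) <= cnorm (diag_blocks ct).
Proof.
by rewrite -(cnorm_mxscalar (n i)); exact: (bfamily_norm_ge (diag_blocks ct) i).
Qed.

Lemma ad_norm_diag_blocks c t (ct : forall i, normc (c i) <= t) :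
  ad_norm (diag_blocks ct) <= 0.
Proof.
apply: ad_norm_le => x _; rewrite (_ : _ - _ = 0) ?cnorm0//.
apply: bfamily_ext => i; apply/eqP; rewrite subr_eq0; apply/eqP.
by rewrite [LHS]mxscalar_mull [RHS]mxscalar_mulr.
Qed.

Lemma block_extension_bounded i (x : mxalg R (n i)) : exists M : R, forall j,
  cnorm (dfwith (fun j => 0 : mxalg R (n j)) i x j) <= M.
Proof.
exists (cnorm x) => j; case: dfwithP => // l _.
by rewrite cnorm0 cnorm_ge0.
Qed.

(** Extending [x] by zero to the other blocks does not increase its norm. *)
Lemma ad_norm_block (a : S) i (x : mxalg R (n i)) :
  cnorm (cmul (a i) x - cmul x (a i)) <= ad_norm a * cnorm x.
Proof.
pose X : S := BFamily (block_extension_bounded x).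
have Xi : X i = x.
  exact: (@dfwithin _ (fun j => mxalg R (n j)) (fun=> 0) i x).
have Xx : cnorm X <= cnorm x.
  apply: bfamily_norm_le => [|j]; first exact: cnorm_ge0.
  by rewrite /X /=; case: dfwithP => // l _; rewrite cnorm0 cnorm_ge0.
apply: le_trans (_ : ad_norm a * cnorm X <= _); last first.
  by rewrite ler_wpM2l// ad_norm_ge0.
apply: le_trans (le_ad_norm a X).
rewrite -{1 2}Xi; exact: (bfamily_norm_ge (cmul a X - cmul X a) i).
Qed.

(** The central element near [a] consists of the upper left entries of its
blocks. *)
Lemma center_dist_matrix_sum : sentence_value S center_dist_sentence <= 0.
Proof.
apply: center_dist_sentence_le => a a1.
pose c i := a i ord0 ord0.
have c1 i : normc (c i) <= 1.
  apply: le_trans (normc_entry_le (a i) ord0 ord0) _.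
  exact: le_trans (bfamily_norm_ge a i) a1.
exists (diag_blocks c1); first exact: diag_blocks_norm.
split; last exact: ad_norm_diag_blocks.
rewrite subr_le0; apply: bfamily_norm_le => [|i]; first exact: ad_norm_ge0.
apply: mx_dist_scalar; first exact: ad_norm_ge0.
exact: ad_norm_block.
Qed.

Lemma decomposable_matrix_sum : k != 0 ->
  sentence_value S decomposable_sentence <= 0.
Proof.
move=> k0.
(* [c true] selects the first block and [c false] all the others. *)
pose c (b : bool) (i : 'I_k.+1) : R[i] := ((i == ord0) == b)%:R.
have c1 b i : normc (c b i) <= 1.
  by rewrite /c; case: (_ == b); rewrite ?normc1 ?normc0 ?ler01.
have norm1 b (i : 'I_k.+1) : (i == ord0) = b -> 1 - cnorm (diag_blocks (c1 b)) <= 0.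
  move=> ib; have := diag_blocks_norm_ge (c1 b) i.
  by rewrite {1}/c ib eqxx normc1 subr_le0.
apply: (@decomposable_sentence_le _ _ _ (diag_blocks (c1 true))
  (diag_blocks (c1 false))).
- exact: diag_blocks_norm.
- exact: diag_blocks_norm.
- exact: ad_norm_diag_blocks.
- exact: ad_norm_diag_blocks.
- rewrite (_ : cmul _ _ = 0) ?cnorm0//; apply: bfamily_ext => i.
  rewrite [LHS]mxscalar_mull /c; case i0 : (i == ord0); last exact: scale0r.
  rewrite scale1r; apply: cnorm0_eq0.
  by rewrite [LHS]cnorm_mxscalar i0 normc0.
- by apply: (norm1 _ ord0); rewrite eqxx.
- apply: (norm1 _ ord_max); apply/negP => /eqP/(congr1 val) /= k0'.
  by rewrite k0' in k0.
Qed.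

End Blocks.

Section MatrixSentences.
Context {R : realType} (n : nat).
Local Notation M := (mxalg R n).

Lemma has_unit_mxalg : sentence_value M has_unit_sentence <= 0.
Proof.
apply: (@has_unit_sentence_le _ _ _ (mxscalar n 1)).
  by rewrite cnorm_mxscalar normc1.
by move=> x _; rewrite mxscalar_mull mxscalar_mulr scale1r subrr cnorm0.
Qed.

Lemma scalar_mxalg (L : seq R[i]) (t : R) :
  (forall c, normc c <= 1 -> exists2 d, d \in L & normc (c - d) <= t) ->
  sentence_value M (scalar_sentence L) <= t.
Proof.
move=> Lt; apply: scalar_sentence_le => a a1.
have [d dL cd] := Lt _ (le_trans (normc_entry_le a ord0 ord0) a1).
exists d; rewrite ?inE ?dL ?orbT// => x x1.
have -> : cmul a x - d *: x = (a ord0 ord0 - d) *: x +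
    cmul (a - mxscalar n (a ord0 ord0)) x.
  by rewrite cmulBl mxscalar_mull scalerBl [RHS]addrC addrA subrK.
apply: le_trans (cnormD _ _) _; apply: lerD.
  by rewrite cnormZ (le_trans _ cd)// ler_piMr ?normc_ge0.
apply: le_trans (cnormM _ _) _; rewrite (le_trans (ler_piMr _ x1)) ?cnorm_ge0//.
by apply: mx_dist_scalar; [exact: ad_norm_ge0|move=> y; exact: le_ad_norm].
Qed.

End MatrixSentences.

(** * Algebras with scalar center *)

Section Scalars.
Context {R : realType}.

Lemma normc_le_abs (x y : R) : normc (x +i* y) <= `|x| + `|y|.
Proof.
rewrite -[leRHS]ger0_norm ?addr_ge0// -sqrtr_sqr /= ler_wsqrtr//.
rewrite sqrrD !real_normK ?num_real// -addrA lerD2l lerDr.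
by rewrite mulrn_wge0 ?mulr_ge0.
Qed.

Lemma real_net (t : R) : 0 < t -> exists L : seq R,
  forall x, `|x| <= 1 -> exists2 y, y \in L & `|x - y| <= t.
Proof.
move=> t0; exists [seq i%:R * t - 1 | i <- iota 0 (Num.truncn (2 / t)).+1].
move=> x; rewrite ler_norml => /andP[x0 x1].
have xt : 0 <= (x + 1) / t by apply: divr_ge0; lra.
pose i := Num.truncn ((x + 1) / t); exists (i%:R * t - 1).
  apply/mapP; exists i => //; rewrite mem_iota add0n ltnS /=.
  by apply: le_truncn; rewrite ler_pM2r ?invr_gt0//; lra.
have /andP[] := truncn_itv xt; rewrite -/i ler_pdivlMr// ltr_pdivrMr// => i0 i1.
rewrite ler_norml; apply/andP; split; first by lra.
by move: i1; rewrite -natr1 mulrDl mul1r; lra.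
Qed.

Lemma disc_net (t : R) : 0 < t -> exists L : seq R[i],
  forall c, normc c <= 1 -> exists2 d, d \in L & normc (c - d) <= t.
Proof.
move=> t0; have [L HL] := real_net (divr_gt0 t0 (ltr0n _ 2)).
exists [seq x +i* y | x <- L, y <- L] => -[a b] ab1.
have abs_le : `|a| <= normc (a +i* b) /\ `|b| <= normc (a +i* b).
  by split; rewrite -sqrtr_sqr /= ler_wsqrtr// ?lerDl ?lerDr sqr_ge0.
have [x xL ax] := HL _ (le_trans abs_le.1 ab1).
have [y yL bY] := HL _ (le_trans abs_le.2 ab1).
exists (x +i* y); first by apply/allpairsP; exists (x, y).
by apply: le_trans (normc_le_abs (a - x) (b - y)) _; rewrite [leRHS]splitr lerD.
Qed.

Context (A : cstarType R) (I : A) (hI : is_identity I).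

Lemma star_identity : star I = I.
Proof.
have [_ E] := hI (star I).
by rewrite -[LHS]E -{2}[I]starK -starM E starK.
Qed.

Lemma cnorm_identity : cnorm I = 0 \/ cnorm I = 1.
Proof.
have := cnorm_star_id I; rewrite star_identity (hI I).1 => /eqP.
have [->|I0] := eqVneq (cnorm I) 0; first by left.
rewrite expr2 -{1}[cnorm I]mulr1 => /eqP/(mulfI I0) <-.
by right.
Qed.

(** The zero algebra has identity [0] and is treated apart; otherwise scalars
converge when their multiples of the identity do. *)
Lemma scalars_closed (a : A) :
  (forall t : R, 0 < t -> exists c, cnorm (a - c *: I) <= t) ->
  exists c, a = c *: I.
Proof.
move=> aI; have [I0|I1] := cnorm_identity.
  exists 0; rewrite scale0r -[a](hI a).1 (cnorm0_eq0 I0).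
  by rewrite -(scale0r (0 : A)) -cscalerAl !scale0r.
have /choice[c Hc] n : exists c, cnorm (a - c *: I) <= 2^-1 ^+ n.
  exact/aI/half_expn_gt0.
(* Complex scalars are 1 x 1 matrices, which form a complete space. *)
have [n m nm|l Hl] := @geometric_cauchy_cvg _ _ (fun n => mxscalar 0 (c n)) 2.
  rewrite (_ : _ - _ = mxscalar 0 (c m - c n)); last first.
    by rewrite /mxscalar rmorphB.
  have -> : cnorm (mxscalar 0 (c m - c n)) = cnorm (c m *: I - c n *: I).
    by rewrite cnorm_mxscalar -scalerBl cnormZ I1 mulr1.
  apply: le_trans (cnorm_dist_trans a _ _) _; rewrite cnorm_distC.
  by have := Hc m; have := Hc n; have := @half_expn_le R _ _ nm; lra.
exists (l ord0 ord0); apply/eqP; rewrite -subr_eq0; apply/eqP.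
apply: cnorm_small_eq0 => t /(half_expn_small 3)[n nt].
apply: le_trans (cnorm_dist_trans (c n *: I) _ _) _.
rewrite -scalerBl cnormZ I1 mulr1.
have : normc (c n - l ord0 ord0) <= 2 * 2^-1 ^+ n.
  apply: le_trans (Hl n); rewrite cnorm_distC.
  have := normc_entry_le (mxscalar 0 (c n) - l) ord0 ord0.
  by rewrite !mxE.
by have := Hc n; lra.
Qed.

Lemma center_scalars :
  (forall t : R, 0 < t -> exists L, sentence_value A (scalar_sentence L) <= t) ->
  cstar_center A = [set c *: I | c in [set: R[i]]].
Proof.
move=> AL; apply/seteqP; split=> [a ca|_ [c _ <-] x]; last first.
  by rewrite -cscalerAl -cscalerAr (hI x).1 (hI x).2.
have [c [y [c0 y1 ay]]] := scale_unit_ball a.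
have cy : ad_norm y = 0.
  apply/eqP; rewrite eq_le ad_norm_ge0 andbT; apply: ad_norm_le => x _.
  have -> : y = c^-1 *: a by rewrite ay scalerA mulVf// scale1r.
  by rewrite -cscalerAl -cscalerAr ca subrr cnorm0.
have I1 : cnorm I <= 1 by have [->|->] := cnorm_identity; rewrite ?ler01.
have [t /AL[L AtL]|d yd] := @scalars_closed y.
  have [d Hd] := le_scalar_sentence AtL y1; exists d.
  by have := Hd I I1; rewrite (hI y).2 cy addr0.
by exists (c * d) => //; rewrite ay yd scalerA.
Qed.

End Scalars.

Section DirectSummands.
Context {R : realType}.

Lemma matrix_sum_one (n : 'I_1 -> nat) (phi : sentence R) :
  sentence_value (matrix_sum R n) phi = sentence_value (mxalg R (n ord0)) phi.
Proof.
pose f (a : matrix_sum R n) : mxalg R (n ord0) := a ord0.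
apply: (@sentence_value_morph _ _ _ f) => // [y|a].
  exists (BFamily (block_extension_bounded y)).
  exact: (@dfwithin _ (fun j => mxalg R (n j)) (fun=> 0) ord0 y).
apply/eqP; rewrite eq_le (bfamily_norm_ge a ord0).
by apply: bfamily_norm_le => [|i]; rewrite ?cnorm_ge0// (ord1 i).
Qed.

Lemma finite_dimensionalP (A : cstarType R) : finite_dimensional A ->
  exists k (n : 'I_k.+1 -> nat), forall phi : sentence R,
    sentence_value A phi = sentence_value (matrix_sum R n) phi.
Proof.
move=> [k [n [f [[g fK gK] fM fstar fnorm]]]]; exists k, n => phi.
have f_surj y : exists x, f x = y by exists (g y).
have fD x y : f (x + y) = f x + f y by exact: linearD.
have fZ c x : f (c *: x) = c *: f x by exact: linearZ.
exact (sentence_value_morph f_surj fD fZ fM fstar fnorm phi).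
Qed.

(** Scalars of modulus close to one cannot have a product close to zero. *)
Lemma center_not_scalars (A : cstarType R) :
  sentence_value A center_dist_sentence <= 0 ->
  sentence_value A decomposable_sentence <= 0 ->
  ~ exists2 I : A, is_identity I &
      cstar_center A = [set c *: I | c in [set: R[i]]].
Proof.
move=> Ac Ad [I hI cI].
(* With tolerance 1/64 the central elements are within 1/16, so the scalars have
   modulus above 7/8 while their product has modulus below 1/4. *)
have t0 : 0 < 64^-1 :> R by rewrite invr_gt0.
have [p [q [[p1 q1 cp cq] [pq p1' q1']]]] :=
  decomposable_sentence_lt (le_lt_trans Ad t0).
have := central_near Ac p1 cp; rewrite cI => -[_ [c _ <-] pc].
have := central_near Ac q1 cq; rewrite cI => -[_ [d _ <-] qd].
have near_norm (x y : A) : cnorm x <= cnorm (x - y) + cnorm y.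
  by rewrite -{1}[x](subrK y) cnormD.
have := near_norm p (c *: I); have := near_norm q (d *: I).
have := near_norm (d *: I) q; rewrite [cnorm (_ - q)]cnorm_distC !cnormZ.
have [->|I1] := cnorm_identity hI; first by rewrite !mulr0; lra.
rewrite I1 !mulr1; set P := normc c; set Q := normc d => dq qd' pc'.
have PQ : P * Q <= cnorm (cmul p q) + (cnorm (p - c *: I) * Q + cnorm (q - d *: I)).
  have -> : P * Q = cnorm (cmul (c *: I) (d *: I)).
    by rewrite -cscalerAl -cscalerAr (hI I).1 !cnormZ I1 mulr1.
  apply: le_trans (near_norm _ (cmul p q)) _; rewrite addrC lerD2l.
  apply: le_trans (cnorm_dist_trans (cmul p (d *: I)) _ _) _.
  rewrite -cmulBl -cmulBr; apply: lerD.
    by apply: le_trans (cnormM _ _) _; rewrite cnormZ I1 mulr1 cnorm_distC.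
  apply: le_trans (cnormM _ _) _; rewrite cnorm_distC.
  by rewrite ler_piMl ?cnorm_ge0.
have Q0 : 0 <= Q := normc_ge0 d.
by nra.
Qed.

End DirectSummands.

(** * Pseudomatricial algebras *)

Lemma pseudomatricial_center (R : realType) (A : cstarType R) :
  pseudomatricial A ->
  exists2 I : A, is_identity I & cstar_center A = [set c *: I | c in [set: R[i]]].
Proof.
move=> [J [U [UU [n AB]]]].
have [|I hI] := @identity_of_approx _ A.
  move=> t t0; apply: has_unit_sentence_lt; apply: le_lt_trans t0.
  apply: (sentence_value_le AB); apply: filterE => j.
  exact: has_unit_mxalg.
exists I => //; apply: (center_scalars hI) => t t0.
have [L Lt] := disc_net t0; exists L.
apply: (sentence_value_le AB); apply: filterE => j.
exact: scalar_mxalg.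
Qed.

Lemma matrix_blocks_pseudomatricial (R : realType) (A : cstarType R)
    (J : Type) (U : set_system J) (UU : UltraFilter U) (F : J -> cstarType R) :
  elementarily_equivalent A (ultraproduct UU F) ->
  (\forall j \near U, exists m, forall phi : sentence R,
     sentence_value (F j) phi = sentence_value (mxalg R m) phi) ->
  pseudomatricial A.
Proof.
move=> AB FM.
have /choice[n Hn] (j : J) : exists m, (exists m', forall phi : sentence R,
    sentence_value (F j) phi = sentence_value (mxalg R m') phi) ->
    forall phi : sentence R, sentence_value (F j) phi = sentence_value (mxalg R m) phi.
  have [[m Hm]|nH] := pselect (exists m', forall phi : sentence R,
    sentence_value (F j) phi = sentence_value (mxalg R m') phi); first by exists m.
  (* These indices avoid a set of the ultrafilter, so any size will do. *)
  by exists 0.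
exists J, U, UU, n => phi; rewrite AB.
have h := @los_sentence _ _ _ UU (fun j => mxalg R (n j)) phi.
apply: (cvg_unique (@Rhausdorff R) (@los_sentence _ _ _ UU F phi)).
apply: cvg_trans h; apply: near_eq_cvg.
by apply: filterS FM => j /Hn ->.
Qed.

Lemma center_scalars_pseudomatricial (R : realType) (A : cstarType R) :
  pseudocompact A ->
  (exists2 I : A, is_identity I & cstar_center A = [set c *: I | c in [set: R[i]]]) ->
  pseudomatricial A.
Proof.
move=> [J [U [UU [F [fdF AB]]]]] AI.
pose K := [set j | exists m, forall phi : sentence R,
  sentence_value (F j) phi = sentence_value (mxalg R m) phi].
have [UK|UK] := in_ultra_setVsetC K UU.
  exact: matrix_blocks_pseudomatricial AB UK.
exfalso; apply: center_not_scalars AI.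
  apply: (sentence_value_le AB); apply: filterE => j.
  by have [k [n ->]] := finite_dimensionalP (fdF j); exact: center_dist_matrix_sum.
apply: (sentence_value_le AB); apply: filterS UK => j /= nKj.
have [k [n Fj]] := finite_dimensionalP (fdF j).
rewrite Fj; apply: decomposable_matrix_sum; apply/eqP => k0; apply: nKj.
by subst k; exists (n ord0) => phi; rewrite Fj matrix_sum_one.
Qed.

Unset Implicit Arguments.

Theorem proposition6p1 (R : realType) (A : cstarType R) (hA : pseudocompact A) :
  pseudomatricial A <->
  exists2 I : A, is_identity I & cstar_center A = [set c *: I | c in [set: R[i]]].
Proof.
split; first exact: pseudomatricial_center.
exact: center_scalars_pseudomatricial.
Qed.
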